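(* Let $m$ be a nonnegative integer and $\lambda\in(-1/2,3)$ with $\lambda\ne0$. Then for all $x\in(-1,1)$ $$\frac{U_m(x)}{(1-x^2)^{\lambda-1}}=\frac{(m+1)\sqrt{\pi}\,\Gamma(\lambda)}{2\,\Gamma(\lambda+1/2)}\sum_{n=0}^\infty\frac{\lambda+m+2n}{m+n+1}\,\frac{\left\langle{\lambda-1\atop n}\right\rangle\left\langle{\lambda\atop m+n}\right\rangle}{\left\langle{2\lambda\atop m+2n}\right\rangle}\,C_{m+2n}^{(\lambda)}(x).$$ Moreover, the convergence of the series is uniform with respect to $x$ on every compact set contained in $(-1,1)$.
   Context: For a complex number $a$ and a nonnegative integer $n$, the rising factorial is $(a)_n=\prod_{0\le j<n}(a+j)$ (so $(a)_0=1$), and $\left\langle{a\atop n}\right\rangle=\frac{(a)_n}{n!}=(-1)^n\binom{-a}{n}$. $\Gamma$ is the Gamma function. The Gegenbauer polynomials $C_n^{(\lambda)}$, for real $\lambda>-1/2$, $\lambda\neq0$, are defined by the generating function $\frac{1}{(1-2xz+z^2)^{\lambda}}=\sum_{n=0}^\infty C_n^{(\lambda)}(x)z^n$ for $|z|<1$. $U_m$ is the Chebyshev polynomial of the second kind, defined by $U_m(\cos\theta)\sin\theta=\sin((m+1)\theta)$ for $\theta\in\mathbb{R}$. *)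

(* Defs.v *)
From mathcomp Require Import all_boot all_order all_algebra.
From mathcomp Require Import all_classical all_reals all_analysis.
Set Implicit Arguments.
Unset Strict Implicit.
Unset Printing Implicit Defensive.
Import Order.TTheory GRing.Theory Num.Theory numFieldNormedType.Exports.
Local Open Scope classical_set_scope.
Local Open Scope ring_scope.

Definition rising (F : pzRingType) (a : F) (n : nat) : F :=
  \prod_(0 <= j < n) (a + j%:R).

(* <a; n> = (a)_n / n! *)
Definition rbinom (F : unitRingType) (a : F) (n : nat) : F :=
  rising a n / (n`!)%:R.

(* Euler's integral, which represents Gamma s for s > 0. *)
Definition Gamma_integral (R : realType) (s : R) : R :=
  \int[@lebesgue_measure R]_(t in `]0, +oo[) (t `^ (s - 1) * expR (- t)).

(* Real Gamma function, extended to the nonpositive non-integers by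
   Gamma s = Gamma (s + k) / (s)_k; here k is 0 when s > 0, and otherwise the
   least k such that s + k > 0. Its value at the poles 0, -1, -2, ... is junk. *)
Definition Gamma (R : realType) (s : R) : R :=
  let k := Num.truncn (1 - s) in
  Gamma_integral (s + k%:R) / rising s k.

(* For x in [-1, 1] and |z| < 1 the base 1 - 2xz + z^2 is positive, so `^ is the
   genuine real power. Real z already determine the polynomials C n. *)
Definition is_gegenbauer (R : realType) (lambda : R) (C : nat -> {poly R}) :
    Prop :=
  forall x z : R, -1 <= x <= 1 -> `|z| < 1 ->
    series (fun n => (C n).[x] * z ^+ n) @ \oo -->
      ((1 - 2 * x * z + z ^+ 2) `^ lambda)^-1.

Definition is_chebyshevU (R : realType) (m : nat) (U : {poly R}) : Prop :=
  forall theta : R, U.[cos theta] * sin theta = sin (m.+1%:R * theta).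

Definition gegenbauer_term (R : realType) (m : nat) (lambda : R)
    (C : nat -> {poly R}) (x : R) (n : nat) : R :=
  (lambda + m%:R + 2 * n%:R) / (m + n + 1)%:R
  * (rbinom (lambda - 1) n * rbinom lambda (m + n)
     / rbinom (2 * lambda) (m + 2 * n))
  * (C (m + 2 * n)%N).[x].

(* Main.v *)
Require Import Defs.
From mathcomp Require Import all_boot all_order all_algebra.
From mathcomp Require Import all_classical all_reals all_analysis.
From mathcomp Require Import measurable_realfun zify ring lra.
Import Order.TTheory GRing.Theory Num.Theory numFieldNormedType.Exports.
Local Open Scope classical_set_scope.
Local Open Scope ring_scope.

(* Multiplied by m + 1, the partial sums Q_m of the series satisfy the Chebyshev
   recurrence Q_(m+2) = 2 x Q_(m+1) - Q_m, and Q_1 = 2 x Q_0, up to one boundary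
   term of size N^(lambda - 3), so only m = 0 is left.  There, with
   w = 1 - x^2, the derivative of w^(lambda - 1) Q_0 is again a single boundary
   term, and (C_(k+2) - C_k)' = 2 (k + 1 + lambda) C_(k+1) allows one to absorb
   it into a small correction; by the mean value theorem
   w^(lambda - 1) Q_0(x) - Q_0(0) tends to 0 uniformly on [-r, r] for r < 1.
   Finally Q_0(0) is a well-poised 4F3 at -1.  Its terminating 5F4 analogue has a
   product formula (Wilf-Zeilberger), and letting the extra parameter tend to
   infinity gives the constant, with Gamma(s + n) / Gamma(s + 1/2 + n)
   controlled by Gamma(s + 1/2) <= sqrt(s) Gamma(s).  The boundary terms are
   bounded by an energy estimate for the three-term recurrence of the C_k. *)

(** * Gegenbauer polynomials *)

(** The boundary term in the derivative of w^(lambda - 1) Q_0 is one power of N larger than the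
    others, of size N^(lambda - 2), and need not be small for lambda >= 2. It is a multiple of
    (C_(2N+2) - C_(2N))' with an extra factor of order 1 / N, so it is integrated instead of
    estimated, which regains that power and reaches all lambda < 3.

    The same range shapes the evaluation of Q_0(0): its alternating terms have size n^(lambda - 3),
    so for 2 <= lambda < 3 the series converges only conditionally and no summable majorant carries
    the terminating sums to the limit. Their damping weights lie in [0, 1] and decrease, hence the
    damped terms still alternate and eventually decrease, and one Leibniz bound serves every N.

    For lambda in (-1/2, 0) Euler's integral diverges at lambda; [Gamma lambda] is therefore always
    reached through lambda Gamma(lambda) = Gamma(lambda + 1), and all other arguments of Gamma are
    positive. *)

Fixpoint geg2 (R : realType) (l x : R) (k : nat) : R * R :=
  if k is k'.+1 then
    let: (a, b) := geg2 R l x k' in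
    (b, (2 * x * (k'%:R + 1 + l) * b - (k'%:R + 2 * l) * a) / (k'%:R + 2))
  else (1, 2 * l * x).
Arguments geg2 {R}.

Definition geg (R : realType) (l x : R) (k : nat) : R := (geg2 l x k).1.
Arguments geg {R}.

(** A classical identity between C_(k+1)', C_k' and C_k serves as definition, so that relations
    between derivatives become inductions; [is_derive_geg] justifies it afterwards. *)
Fixpoint dgeg (R : realType) (l x : R) (k : nat) : R :=
  if k is k'.+1 then x * dgeg R l x k' + (k'%:R + 2 * l) * geg l x k' else 0.
Arguments dgeg {R}.

Section Gegenbauer.
Context {R : realType}.
Implicit Types (l x : R) (k : nat).

Lemma natr_neq0 k j : k%:R + j.+1%:R != 0 :> R.
Proof. by rewrite -natrD pnatr_eq0 addnS. Qed.

Lemma geg0 l x : geg l x 0 = 1. Proof. by []. Qed.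

Lemma geg1 l x : geg l x 1 = 2 * l * x. Proof. by []. Qed.

Lemma geg_rec l x k :
  (k%:R + 2) * geg l x k.+2 =
  2 * x * (k%:R + 1 + l) * geg l x k.+1 - (k%:R + 2 * l) * geg l x k.
Proof.
rewrite /geg /=; case: (geg2 l x k) => a b /=.
by field; exact: natr_neq0.
Qed.

(** Companion of the defining recursion of [dgeg]: eliminating between the two gives [dgeg_add2] and
    [dgeg_struct]. *)
Lemma dgeg_down l x k :
  dgeg l x k = x * dgeg l x k.+1 - (k%:R + 1) * geg l x k.+1.
Proof.
elim: k => [|k IH]; first by rewrite /= geg0 geg1; ring.
have Hr := geg_rec l x k.
have E : dgeg l x k.+2 = x * dgeg l x k.+1 + (k.+1%:R + 2 * l) * geg l x k.+1.
  by [].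
have E1 : dgeg l x k.+1 = x * dgeg l x k + (k%:R + 2 * l) * geg l x k by [].
rewrite E -natr1.
have -> : x * (x * dgeg l x k.+1 + (k%:R + 1 + 2 * l) * geg l x k.+1) -
   (k%:R + 1 + 1) * geg l x k.+2 =
   x * (x * dgeg l x k.+1 + (k%:R + 1 + 2 * l) * geg l x k.+1) -
   (k%:R + 2) * geg l x k.+2 by ring.
rewrite Hr [LHS]E1 {1}IH; ring.
Qed.

Lemma dgeg_add2 l x k :
  dgeg l x k.+2 - dgeg l x k = 2 * (k%:R + 1 + l) * geg l x k.+1.
Proof. by rewrite (dgeg_down l x k) /= -natr1; ring. Qed.

Lemma dgeg_struct l x k :
  (1 - x ^+ 2) * dgeg l x k.+1 =
  (k%:R + 2 * l) * geg l x k - (k%:R + 1) * x * geg l x k.+1.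
Proof.
have E1 : dgeg l x k.+1 = x * dgeg l x k + (k%:R + 2 * l) * geg l x k by [].
have -> : (1 - x ^+ 2) * dgeg l x k.+1 = dgeg l x k.+1 - x * (x * dgeg l x k.+1) by ring.
rewrite [in X in X - _]E1 {1}(dgeg_down l x k); ring.
Qed.

Lemma is_derive_geg l x k : is_derive x 1 (fun y => geg l y k) (dgeg l x k).
Proof.
suff [] : is_derive x 1 (fun y => geg l y k) (dgeg l x k) /\
   is_derive x 1 (fun y => geg l y k.+1) (dgeg l x k.+1) by [].
elim: k => [|k [IH0 IH1]].
  split; first exact: is_derive_cst.
  have -> : dgeg l x 1 = 2 * l * 1 by rewrite /= geg0; ring.
  have -> : (fun y => geg l y 1) = (2 * l) \*: (fun y : R => y).
    by apply/funext.
  exact: is_deriveZ.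
split=> //.
have -> : (fun y => geg l y k.+2) = (k%:R + 2)^-1 \*:
    ((2 * (k%:R + 1 + l)) \*: ((fun y : R => y) * (fun y => geg l y k.+1)) -
     (k%:R + 2 * l) \*: (fun y => geg l y k)).
  apply/funext => y /=.
  apply: (mulfI (natr_neq0 k 1)).
  rewrite geg_rec !fctE /= /GRing.scale/= mulrA divff ?natr_neq0 // mul1r; ring.
apply: is_derive_eq.
rewrite /GRing.scale /=.
apply: (mulfI (natr_neq0 k 1)).
rewrite mulrA divff ?natr_neq0 // mul1r.
have -> : (k%:R + 2) * (x * (x * dgeg l x k + (k%:R + 2 * l) * geg l x k) +
   (k.+1%:R + 2 * l) * geg l x k.+1) = (k%:R + 2) * (x * dgeg l x k.+1 +
   (k.+1%:R + 2 * l) * geg l x k.+1) by [].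
rewrite -[x * dgeg l x k + _]/(dgeg l x k.+1) {1}(dgeg_down l x k).
rewrite -[k.+1%:R]natr1; ring.
Qed.

End Gegenbauer.

Section Rising.
Context {R : realType}.
Implicit Types (a l x : R).

Lemma rising0 a : rising a 0 = 1. Proof. by rewrite /rising big_geq. Qed.

Lemma risingS a n : rising a n.+1 = rising a n * (a + n%:R).
Proof. by rewrite /rising big_nat_recr. Qed.

Lemma rbinom0 a : rbinom a 0 = 1.
Proof. by rewrite /rbinom rising0 divr1. Qed.

Lemma rbinomS a n : rbinom a n.+1 = rbinom a n * ((a + n%:R) / (n%:R + 1)).
Proof.
rewrite /rbinom risingS factS natrM -natr1 invfM; ring.
Qed.

Lemma rising_neq0 a n : -1 < a -> a != 0 -> rising a n != 0.
Proof.
move=> a1 a0; elim: n => [|n IH]; first by rewrite rising0 oner_neq0.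
rewrite risingS mulf_neq0 //; case: n {IH} => [|n]; first by rewrite addr0.
by rewrite gt_eqF // -natr1; have := ler0n R n; lra.
Qed.

Lemma rbinom_neq0 a n : -1 < a -> a != 0 -> rbinom a n != 0.
Proof.
move=> a1 a0; by rewrite mulf_neq0 ?rising_neq0 // invr_neq0 // pnatr_eq0 -lt0n fact_gt0.
Qed.

End Rising.

(** * Growth of the Gegenbauer polynomials on [-r, r] *)

Section GegenbauerBound.
Context {R : realType}.
Implicit Types (l x r K : R).

(* The energy [v_(k+1)^2 - 2 x v_(k+1) v_k + v_k^2], a definite form since
   |x| < 1, is nearly conserved: it grows by a factor 1 + O(1/k^2) per step. *)
Lemma perturbed_chebyshev_bound r K x (v eta : nat -> R) :
  0 < r < 1 -> 0 <= K -> `|x| <= r -> v 0%N = 1 -> v 1%N = 2 * x ->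
  (forall k, v k.+2 = 2 * x * v k.+1 - (1 - eta k) * v k) ->
  (forall k, `|eta k| <= K / ((k%:R + 1) * (k%:R + 2))) ->
  forall k, `|v k| <= 1 + expR (K * (3 + K) / (1 - r)) / (1 - r).
Proof.
move=> /andP[r0 r1] K0 xr v0 v1 vrec etaK k.
(* The error terms of one step, [A1] and [A2] below, are at most h and h (2 + K) times v_(j+1)^2 +
   v_j^2, and this sum of squares is at most E_j / (1 - r). *)
pose D := K * (3 + K) / (1 - r).
pose E k := v k.+1 ^+ 2 - 2 * x * v k.+1 * v k + v k ^+ 2.
have r1' : 0 < 1 - r by lra.
have D0 : 0 <= D by rewrite divr_ge0 ?mulr_ge0 //; lra.
have Epos j : (1 - r) * (v j.+1 ^+ 2 + v j ^+ 2) <= E j.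
  rewrite /E; set b := v j.+1; set a := v j.
  have [/ler_normlP [x1 x2]] : `|x| <= r /\ True by [].
  have h1 := sqr_ge0 (b - a); have h2 := sqr_ge0 (b + a).
  have h3 : 0 <= (r + x) * (b + a) ^+ 2 by rewrite mulr_ge0 //; lra.
  have h4 : 0 <= (r - x) * (b - a) ^+ 2 by rewrite mulr_ge0 //; lra.
  by nra.
(* 1 - 1 / (j + 1) is the telescoped sum of 1 / ((i + 1) (i + 2)) over i < j, so the growth factors
   multiply up to at most exp D. *)
have Eexp j : E j <= expR (D * (1 - (j%:R + 1)^-1)).
  elim: j => [|j IH].
    by rewrite /E v0 v1 add0r invr1 subrr mulr0 expR0; lra.
  set h := K / ((j%:R + 1) * (j%:R + 2)).
  have j0 := ler0n R j.
  have hK : 0 <= h <= K.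
    apply/andP; split; first by rewrite divr_ge0 // mulr_ge0 //; lra.
    rewrite ler_pdivrMr; last by rewrite mulr_gt0 //; lra.
    by rewrite ler_peMr //; nra.
  have etah : `|eta j| <= h := etaK j.
  have hdef : h = K / ((j%:R + 1) * (j%:R + 2)) by [].
  clearbody h.
  have -> : D * (1 - (j.+1%:R + 1)^-1) =
      D * (1 - (j%:R + 1)^-1) + D / ((j%:R + 1) * (j%:R + 2)).
    by rewrite -natr1; field; apply/andP; split; rewrite gt_eqF //; lra.
  rewrite expRD.
  have step : E j.+1 <= E j * (1 + D / ((j%:R + 1) * (j%:R + 2))).
    have -> : E j.+1 = E j + eta j * (2 * x * v j.+1 * v j) +
        (eta j ^+ 2 - 2 * eta j) * v j ^+ 2.
      by rewrite /E vrec; ring.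
    rewrite mulrDr mulr1 -addrA lerD2l.
    have -> : E j * (D / ((j%:R + 1) * (j%:R + 2))) =
       h * (3 + K) / (1 - r) * E j.
      by rewrite /D hdef; field; do !(apply/andP; split); rewrite gt_eqF //; lra.
    apply: (@le_trans _ _ (h * (3 + K) * (v j.+1 ^+ 2 + v j ^+ 2))); last first.
      have := Epos j.
      rewrite -[X in _ <= X -> _](mulVKf (lt0r_neq0 r1')) => H.
      rewrite -!mulrA ler_wpM2l //; first by case/andP: hK.
      rewrite ler_wpM2l //; first lra.
      by move: H; rewrite ler_pM2l.
    have S0 : 0 <= v j.+1 ^+ 2 + v j ^+ 2 by rewrite addr_ge0 ?sqr_ge0.
    have A1 : eta j * (2 * x * v j.+1 * v j) <= h * (v j.+1 ^+ 2 + v j ^+ 2).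
      apply: (le_trans (ler_norm _)); rewrite normrM ler_pM //.
      rewrite -!mulrA normrM gtr0_norm // normrM.
      apply: (@le_trans _ _ (2 * (1 * `|v j.+1 * v j|))).
        by rewrite ler_pM2l // ler_wpM2r //; lra.
      rewrite mul1r normrM -[v j.+1 ^+ 2]real_normK ?num_real //.
      rewrite -[v j ^+ 2]real_normK ?num_real //.
      by have := sqr_ge0 (`|v j.+1| - `|v j|); nra.
    have A2 : (eta j ^+ 2 - 2 * eta j) * v j ^+ 2 <=
        h * (2 + K) * (v j.+1 ^+ 2 + v j ^+ 2).
      apply: (@le_trans _ _ (h * (2 + K) * v j ^+ 2)); last first.
        rewrite ler_wpM2l ?lerDr ?sqr_ge0 //.
        by case/andP: hK => hK _; rewrite mulr_ge0 //; lra.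
      rewrite ler_wpM2r ?sqr_ge0 //; apply: (le_trans (ler_norm _)).
      have -> : eta j ^+ 2 - 2 * eta j = eta j * (eta j - 2) by ring.
      rewrite normrM ler_pM //.
      apply: (le_trans (ler_normB _ _)); rewrite (gtr0_norm (_ : 0 < 2)) //.
      by case/andP: hK => _ hK; rewrite addrC lerD2l (le_trans etah).
    by have := lerD A1 A2; nra.
  apply: (le_trans step).
  have p0 : 0 <= 1 + D / ((j%:R + 1) * (j%:R + 2)).
    by rewrite addr_ge0 // divr_ge0 // mulr_ge0 //; lra.
  apply: ler_pM => //; last exact: expR_ge1Dx.
  apply: le_trans (Epos j); apply: mulr_ge0; first exact: ltW.
  by rewrite addr_ge0 ?sqr_ge0.
have ED : E k <= expR D.
  by apply: (le_trans (Eexp k)); rewrite ler_expR ler_piMr.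
have vk2 : v k ^+ 2 <= expR D / (1 - r).
  rewrite ler_pdivlMr // mulrC; apply: le_trans ED; apply: le_trans (Epos k).
  by rewrite ler_pM2l // lerDr sqr_ge0.
apply: le_trans (lerD (lexx 1) vk2).
rewrite -[v k ^+ 2]real_normK ?num_real //.
by have := sqr_ge0 (`|v k| - 1); nra.
Qed.

(** Division by [rbinom l k] turns the recurrence of the C_k into the Chebyshev recurrence perturbed
    by [eta], which is of order 1 / k^2. For negative l the divisor is negative from k = 1 on,
    whence its absolute value in the bound. *)
Lemma geg_bound l r : - (1 / 2) < l -> l != 0 -> 0 < r < 1 ->
  exists M, forall k x, `|x| <= r -> `|geg l x k| <= M * `|rbinom l k|.
Proof.
move=> l12 l0 r01.
pose eta k := l * (l - 1) / ((k%:R + 1 + l) * (k%:R + l)).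
(* For k >= 1 the quotient (k + 1) (k + 2) / ((k + 1/2) (k - 1/2)) is at most 8, its value at k = 1.
   The other summand settles k = 0, where k + l can be negative or close to 0. *)
pose K := `|l * (l - 1)| * (8 + 2 / `|(1 + l) * l|).
have K0 : 0 <= K by rewrite mulr_ge0 // addr_ge0 // divr_ge0.
have l1 : -1 < l by lra.
have kl k : k%:R + l != 0.
  case: k => [|k]; first by rewrite add0r.
  by rewrite gt_eqF // -natr1; have := ler0n R k; lra.
have kl1 k : k%:R + 1 + l != 0 by rewrite natr1 kl.
exists (1 + expR (K * (3 + K) / (1 - r)) / (1 - r)) => k x xr.
have b0 j := @rbinom_neq0 R l j l1 l0.
have -> : geg l x k = geg l x k / rbinom l k * rbinom l k by rewrite divfK.
rewrite normrM ler_wpM2r //.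
apply: (@perturbed_chebyshev_bound r K x (fun k => geg l x k / rbinom l k) eta)
  => // {k}.
- by rewrite geg0 rbinom0 divr1.
- by rewrite geg1 rbinomS rbinom0 mul1r addr0 add0r divr1; field.
- move=> k; apply: (mulfI (b0 k.+2)); apply: (mulfI (natr_neq0 k 1)).
  rewrite [rbinom l k.+2 * (_ / _)]mulrC divfK // geg_rec !rbinomS -!natr1 /eta.
  by have k0 := ler0n R k; field; do ?[apply/andP; split];
    rewrite ?kl ?kl1 ?b0.
- move=> k; rewrite /eta normrM normfV /K.
  have k0 := ler0n R k.
  have P : 0 < (k%:R + 1) * (k%:R + 2) :> R by rewrite mulr_gt0 //; lra.
  rewrite -[leRHS]mulrA ler_wpM2l // ler_pdivlMr //.
  have [->|kn0] := eqVneq k 0%N.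
    rewrite !add0r; set z := `|_|; have z0 : 0 <= z^-1 by rewrite invr_ge0 /z.
    lra.
  have k1 : 1 <= k%:R :> R by rewrite ler1n lt0n.
  have q0 : 0 <= 2 / `|(1 + l) * l| by rewrite divr_ge0.
  apply: (@le_trans _ _ 8); last by lra.
  have p1 : 0 < k%:R + l by lra.
  rewrite gtr0_norm; last by rewrite mulr_gt0 //; lra.
  rewrite ler_pdivrMl; last by rewrite mulr_gt0 //; lra.
  have : (k%:R + 1 / 2) * (k%:R - 1 / 2) <= (k%:R + 1 + l) * (k%:R + l).
    by apply: ler_pM; lra.
  nra.
Qed.

End GegenbauerBound.

(** * Recurrence from the generating function *)

Section PowerSeries.
Context {R : realType}.
Implicit Types (c d : nat -> R) (x z k L : R).

Definition shift_coef c n : R := if n is n'.+1 then c n' else 0.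

Lemma cvg_pseriesD c d z L k : pseries c z @ \oo --> L ->
  pseries d z @ \oo --> k -> pseries (fun n => c n + d n) z @ \oo --> L + k.
Proof.
move=> Hc Hd; rewrite (_ : pseries _ z = fun n => pseries c z n + pseries d z n).
  exact: cvgD.
apply/funext => n; rewrite /pseries /series /= -big_split /=.
by apply: eq_bigr => i _; rewrite mulrDl.
Qed.

Lemma cvg_pseriesZ c z L k : pseries c z @ \oo --> L ->
  pseries (fun n => k * c n) z @ \oo --> k * L.
Proof.
move=> Hc; rewrite (_ : pseries _ z = fun n => k * pseries c z n).
  by apply: cvgM => //; exact: cvg_cst.
apply/funext => n; rewrite /pseries /series /= mulr_sumr.
by apply: eq_bigr => i _; rewrite mulrA.
Qed.

Lemma cvg_pseries_shift c z L : pseries c z @ \oo --> L ->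
  pseries (shift_coef c) z @ \oo --> z * L.
Proof.
move=> Hc; rewrite -cvg_shiftS.
rewrite (_ : [sequence _]_n = fun n => z * pseries c z n).
  by apply: cvgM => //; exact: cvg_cst.
apply/funext => n; rewrite /pseries /series /= big_nat_recl //= mul0r add0r.
by rewrite mulr_sumr; apply: eq_bigr => i _; rewrite exprS mulrCA.
Qed.

Lemma pseries_at0 c L : pseries c 0 @ \oo --> L -> L = c 0%N.
Proof.
rewrite -cvg_shiftS (_ : [sequence _]_n = fun=> c 0%N) => [H|].
  by rewrite -(cvg_lim _ H) // lim_cst.
apply/funext => n; rewrite /pseries /series /= big_nat_recl //= mulr1.
by rewrite big1 ?addr0 // => i _; rewrite exprS mul0r mulr0.
Qed.

Lemma bernoulli (k : R) n : 0 <= k -> 1 + n%:R * k <= (1 + k) ^+ n.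
Proof.
move=> k0; elim: n => [|n IH]; first by rewrite mul0r addr0 expr0.
have n0 := ler0n R n.
rewrite exprS -natr1; apply: (@le_trans _ _ ((1 + k) * (1 + n%:R * k))).
  have : 0 <= n%:R * k * k by rewrite !mulr_ge0.
  lra.
by rewrite ler_wpM2l //; lra.
Qed.

(** The room between |z| and 1 pays for the factor n + 1: (n + 1) e <= (1 + e)^n by Bernoulli's
    inequality, and (1 + e) |z| <= y < 1, where the series converges absolutely. *)
Lemma is_cvg_pseries_diffs c : (forall z, `|z| < 1 -> cvgn (pseries c z)) ->
  forall z, `|z| < 1 -> cvgn (pseries (pseries_diffs c) z).
Proof.
move=> Hc z z1; have z0 := normr_ge0 z.
pose e := (1 - `|z|) / 2; pose y := (1 + `|z|) / 2.
have e0 : 0 < e by rewrite /e; lra.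
have y0 : 0 < y by rewrite /y; lra.
have cy : cvgn (pseries (fun i => `|c i|) y).
  apply: (@is_cvg_pseries_inside_norm _ _ ((1 + y) / 2)).
    by apply: Hc; rewrite gtr0_norm /y; lra.
  by rewrite !gtr0_norm /y; lra.
apply: normed_cvg; rewrite /normed_series_of /=.
have S : cvgn (series (fun n => (e * y)^-1 * (`|c n.+1| * y ^+ n.+1))).
  apply: is_cvg_seriesZ.
  move: cy; rewrite /pseries => /cvg_ex [l Hl]; apply/cvg_ex.
  exists (l - `|c 0%N|).
  move: Hl; rewrite -cvg_shiftS => Hl.
  rewrite (_ : series _ = fun n =>
    series (fun i => `|c i| * y ^+ i) n.+1 - `|c 0%N|).
    by apply: cvgB => //; exact: cvg_cst.
  apply/funext => n; rewrite /series /= big_nat_recl //= mulr1.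
  by rewrite addrC addKr.
apply: series_le_cvg S => // n.
  by rewrite !mulr_ge0 ?invr_ge0 ?mulr_ge0 ?exprn_ge0 //; lra.
rewrite /pseries_diffs !normrM normrX (ger0_norm (ler0n R _)).
have -> : (e * y)^-1 * (`|c n.+1| * y ^+ n.+1) = `|c n.+1| * (y ^+ n / e).
  by rewrite exprS; field; rewrite !gt_eqF.
rewrite -mulrA mulrCA ler_wpM2l // ler_pdivlMr // mulrAC.
apply: (@le_trans _ _ ((1 + e) ^+ n * `|z| ^+ n)).
  rewrite ler_wpM2r ?exprn_ge0 //; apply: le_trans (bernoulli e n (ltW e0)).
  by rewrite -natr1 mulrDl mul1r /e; lra.
rewrite -exprMn lerXn2r ?nnegrE ?mulr_ge0 //; try lra.
by rewrite /e /y; nra.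
Qed.

Lemma is_derive_pseries c : (forall z, `|z| < 1 -> cvgn (pseries c z)) ->
  forall z, `|z| < 1 -> is_derive z 1 (fun z => limn (pseries c z))
    (limn (pseries (pseries_diffs c) z)).
Proof.
move=> Hc z z1; have z0 := normr_ge0 z.
have Hd := is_cvg_pseries_diffs _ Hc.
have k1 : `|(1 + `|z|) / 2| < 1 by rewrite [X in X < _]gtr0_norm; lra.
apply: (@pseries_snd_diffs _ _ ((1 + `|z|) / 2)).
- exact: Hc.
- exact: Hd.
- exact: is_cvg_pseries_diffs.
- by rewrite [X in _ < X]gtr0_norm; lra.
Qed.

Lemma near_norm_lt1 z : `|z| < 1 -> \forall y \near z, `|y| < 1.
Proof.
move=> z1; apply/nbhs_ballP; exists (1 - `|z|) => /=; first by rewrite subr_gt0.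
move=> y; rewrite /ball /= => h.
have := ler_normB z (z - y); rewrite opprB addrC subrK; lra.
Qed.

(** The value at 0 gives c_0 = 0. The derived series again sums to 0 on the disc, so the induction
    on n, for all c at once, applies to its coefficients (n + 1) c_(n+1). *)
Lemma pseries_eq0 c : (forall z, `|z| < 1 -> pseries c z @ \oo --> (0 : R)) ->
  forall n, c n = 0.
Proof.
move=> H n; elim: n c H => [|n IH] c H.
  by have /H/pseries_at0 : `|0 : R| < 1 by rewrite normr0.
have Hc z : `|z| < 1 -> cvgn (pseries c z).
  by move=> /H h; apply/cvg_ex; exists 0.
have : pseries_diffs c n = 0.
  apply: IH => z z1.
  have C := is_cvg_pseries_diffs _ Hc z z1.
  suff E : limn (pseries (pseries_diffs c) z) = 0 by rewrite -[X in _ --> X]E.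
  have [_ <-] := is_derive_pseries _ Hc z z1.
  rewrite (@near_eq_derive _ _ _ _ (cst 0)); first by rewrite derive_cst.
  near=> y; apply/cvg_lim => //; apply: H.
  by near: y; exact: near_norm_lt1.
by rewrite /pseries_diffs => /eqP; rewrite mulf_eq0 pnatr_eq0 /= => /eqP.
Unshelve. all: by end_near. Qed.

End PowerSeries.

Section GeneratingFunction.
Context {R : realType}.
Implicit Types (l x z : R) (C : nat -> {poly R}).

(** This is B f' = 2 l (x - z) f with B = 1 - 2 x z + z^2, expanded so that each multiplication by z
    matches one use of [cvg_pseries_shift]. *)
Lemma gegenbauer_ode l x z (f : R -> R) (df : R) : -1 < x < 1 -> `|z| < 1 ->
  (forall y, `|y| < 1 -> f y = ((1 - 2 * x * y + y ^+ 2) `^ l)^-1) ->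
  is_derive z 1 f df ->
  df - 2 * x * (z * df) + z * (z * df) - 2 * l * x * f z + 2 * l * (z * f z) = 0.
Proof.
move=> /andP[x1 x2] z1 Hf Hd.
pose B (y : R) : R := 1 - 2 * x * y + y ^+ 2.
have B0 y : 0 < B y.
  have -> : B y = (y - x) ^+ 2 + (1 - x) * (1 + x) by rewrite /B; ring.
  by rewrite ltr_wpDl ?sqr_ge0 // mulr_gt0; lra.
have dB (y : R) : is_derive y 1 B (2 * y - 2 * x).
  by apply: is_derive_eq; rewrite /GRing.scale /=; ring.
have Hg : is_derive z 1 (fun y => B y `^ (- l))
    (- l * B z `^ (- l - 1) * (2 * z - 2 * x)).
  have dP := is_derive1_powR (- l) (B0 z).
  exact: (@is_derive1_comp _ (fun u => u `^ (- l)) B z _ _ dP (dB z)).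
have E : df = - l * B z `^ (- l - 1) * (2 * z - 2 * x).
  have [_ <-] := Hd; have [_ <-] := Hg.
  apply: near_eq_derive.
  near=> y; rewrite Hf; last by near: y; exact: near_norm_lt1.
  by rewrite powRN.
have -> : f z = B z * B z `^ (- l - 1).
  rewrite Hf // -powRN -/(B z) -{2}[B z]powRr1 ?(ltW (B0 z)) // -powRD.
    by congr (_ `^ _); lra.
  by rewrite (gt_eqF (B0 z)) implybT.
by rewrite E /B; ring.
Unshelve. all: by end_near. Qed.

Lemma gegenbauerE l C x k : is_gegenbauer l C -> -1 < x < 1 ->
  (C k).[x] = geg l x k.
Proof.
move=> HC x11; pose a n := (C n).[x].
have Ha z : `|z| < 1 ->
    pseries a z @ \oo --> ((1 - 2 * x * z + z ^+ 2) `^ l)^-1.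
  by apply: HC; case/andP: x11 => h1 h2; rewrite !ltW.
have Hc z : `|z| < 1 -> cvgn (pseries a z).
  by move=> /Ha h; apply/cvg_ex; eexists; exact: h.
pose d := pseries_diffs a.
(* The coefficient of z^n on the left-hand side of the differential equation. *)
pose e n := d n + (- (2 * x) * shift_coef d n +
  (shift_coef (shift_coef d) n + (- (2 * l * x) * a n + 2 * l * shift_coef a n))).
have e0 n : e n = 0.
  apply: pseries_eq0 => z z1.
  have Da := is_cvg_pseries_diffs _ Hc z z1.
  have Ca := Hc z z1.
  have := gegenbauer_ode l x z (fun z => limn (pseries a z)) _ x11 z1 _
     (is_derive_pseries _ Hc z z1).
  move=> /(_ (fun y y1 => cvg_lim _ (Ha y y1))) E0.
  rewrite -[X in _ --> X](E0 _) //.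
  set D := limn (pseries (pseries_diffs a) z).
  set A := limn (pseries a z).
  have -> : D - 2 * x * (z * D) + z * (z * D) - 2 * l * x * A + 2 * l * (z * A) =
    D + (- (2 * x) * (z * D) + (z * (z * D) + (- (2 * l * x) * A +
    2 * l * (z * A)))) by ring.
  apply: cvg_pseriesD => //; apply: cvg_pseriesD.
    by apply: cvg_pseriesZ; exact: cvg_pseries_shift.
  apply: cvg_pseriesD; first by do 2?apply: cvg_pseries_shift.
  apply: cvg_pseriesD; first exact: cvg_pseriesZ.
  by apply: cvg_pseriesZ; exact: cvg_pseries_shift.
have a0 : a 0%N = 1.
  have z01 : `|0 : R| < 1 by rewrite normr0.
  have := pseries_at0 _ _ (Ha _ z01).
  by rewrite mulr0 subr0 expr0n addr0 powR1 invr1.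
have a1 : a 1%N = 2 * l * x.
  by have := e0 0%N; rewrite /e /d /pseries_diffs /= a0; lra.
have arec j : (j%:R + 2) * a j.+2 =
    2 * x * (j%:R + 1 + l) * a j.+1 - (j%:R + 2 * l) * a j.
  have sh : shift_coef d j = j%:R * a j by case: j => [|j] //=; rewrite mul0r.
  have := e0 j.+1.
  rewrite /e /= sh /d /pseries_diffs.
  by rewrite -!natr1 => H; apply/eqP; rewrite -subr_eq0 -[X in _ == X]H; apply/eqP; ring.
suff [] : a k = geg l x k /\ a k.+1 = geg l x k.+1 by [].
elim: k => [|k [IH1 IH2]]; first by rewrite geg0 geg1.
split=> //; apply: (mulfI (natr_neq0 k 1)).
by rewrite arec geg_rec IH1 IH2.
Qed.

End GeneratingFunction.

(** * The Gamma function *)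

Section Trunc.
Context {R : realType}.
Notation mu := (@lebesgue_measure R).
Implicit Types (s t : R).

Definition gamma_fun s t : R := t `^ (s - 1) * expR (- t).

(** With values in the extended reals, the functional equation can be proved before finiteness,
    which is then deduced from it. *)
Definition gammaE s : \bar R := (\int[mu]_(t in `]0%R, +oo[) (gamma_fun s t)%:E)%E.

(** The interval for p = 2 is the image of that for p = 1 under t -> t^2, as the substitution in
    [Gamma_integral12] requires. Starting from n + 2 keeps it nondegenerate for p > 0. *)
Definition trunc_itv (p n : nat) : set R := `[n.+2%:R ^- p, n.+2%:R ^+ p].

Lemma trunc_itv_gt0 p n t : trunc_itv p n t -> 0 < t.
Proof.
rewrite /trunc_itv /= in_itv /= => /andP[h _]; apply: lt_le_trans h.
by rewrite invr_gt0 exprn_gt0.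
Qed.

Lemma trunc_itv_nd p : nondecreasing_seq (trunc_itv p).
Proof.
apply/nondecreasing_seqP => n; rewrite subsetEset => t.
rewrite /trunc_itv /= !in_itv /= => /andP[h1 h2].
have le : n.+2%:R ^+ p <= n.+3%:R ^+ p :> R.
  by rewrite lerXn2r ?nnegrE // ler_nat.
rewrite (le_trans h2 le) andbT; apply: le_trans h1.
by rewrite lef_pV2 // posrE exprn_gt0.
Qed.

Lemma trunc_itv_bigcup p : (0 < p)%N ->
  \bigcup_n trunc_itv p n = `]0%R, +oo[%classic :> set R.
Proof.
move=> p0; apply/seteqP; split => [t [n _] /trunc_itv_gt0 t0|t] /=.
  by rewrite in_itv /= t0.
rewrite in_itv /= andbT => t0.
exists (Num.truncn (t + t^-1)) => //; rewrite /trunc_itv /= in_itv /=.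
set n := Num.truncn _.
have tn : t + t^-1 < n.+2%:R.
  apply: (lt_trans (truncnS_gt _)); by rewrite ltr_nat.
have ti : 0 < t^-1 by rewrite invr_gt0.
have np : n.+2%:R <= n.+2%:R ^+ p :> R.
  by rewrite -[X in X <= _]expr1 ler_weXn2l // ler1n.
apply/andP; split; last by apply: le_trans np; apply: ltW; apply: lt_trans tn; lra.
rewrite -[leRHS]invrK lef_pV2 ?posrE ?exprn_gt0 //.
by apply: le_trans np; apply: ltW; apply: lt_trans tn; lra.
Qed.

Lemma cvg_trunc_integral p (f : R -> R) : (0 < p)%N ->
  (forall t, 0 < t -> 0 <= f t) -> measurable_fun setT f ->
  (\int[mu]_(t in trunc_itv p n) (f t)%:E)%E @[n --> \oo] -->
  (\int[mu]_(t in `]0%R, +oo[) (f t)%:E)%E.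
Proof.
move=> p0 f0 mf; rewrite -(trunc_itv_bigcup p p0).
apply: ge0_nondecreasing_set_cvg_integral.
- exact: trunc_itv_nd.
- by move=> n; exact: measurable_itv.
- by move=> n; apply/measurable_EFinP/measurable_funTS.
- by move=> n t /trunc_itv_gt0 t0; rewrite lee_fin f0.
Qed.

Lemma gamma_fun_ge0 s t : 0 <= gamma_fun s t.
Proof. by rewrite mulr_ge0 ?powR_ge0 ?expR_ge0. Qed.

Lemma measurable_gamma_fun s : measurable_fun setT (gamma_fun s).
Proof.
apply: measurable_funM; first exact: measurable_powR.
by apply: measurableT_comp => //; exact: measurable_oppr.
Qed.

Lemma measurable_EFin_gamma_fun s (D : set R) :
  measurable_fun D (fun t => (gamma_fun s t)%:E).
Proof.
by apply/measurable_EFinP/measurable_funTS; exact: measurable_gamma_fun.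
Qed.

Lemma continuous_powR s t : 0 < t -> {for t, continuous (fun u : R => u `^ s)}.
Proof.
move=> t0; apply/differentiable_continuous; rewrite -derivable1_diffP.
by apply: derivable_powR; rewrite in_itv /= t0.
Qed.

Lemma continuous_expRN t : {for t, continuous (fun u : R => expR (- u))}.
Proof.
apply: continuous_comp; first exact: opp_continuous.
exact: continuous_expR.
Qed.

Lemma is_derive_NexpRN t :
  is_derive t 1 (fun u : R => - expR (- u)) (expR (- t)).
Proof. by apply: is_derive_eq; rewrite /GRing.scale /=; ring. Qed.

Lemma continuous_NexpRN t : {for t, continuous (fun u : R => - expR (- u))}.
Proof.
apply/differentiable_continuous; rewrite -derivable1_diffP.
by have [] := is_derive_NexpRN t.
Qed.

Lemma continuous_gamma_fun s t : 0 < t -> {for t, continuous (gamma_fun s)}.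
Proof.
move=> t0; apply: cvgM; first exact: continuous_powR.
exact: continuous_expRN.
Qed.

Lemma within_trunc_continuous p n (f : R -> R) :
  (forall t, 0 < t -> {for t, continuous f}) ->
  {within trunc_itv p n, continuous f}.
Proof.
move=> cf; apply/subspace_continuousP => t /trunc_itv_gt0 t0.
apply: cvg_within_filter; exact: cf.
Qed.

Lemma integrable_trunc p n (f : R -> R) :
  (forall t, 0 < t -> {for t, continuous f}) ->
  mu.-integrable (trunc_itv p n) (EFin \o f).
Proof.
move=> cf; apply: continuous_compact_integrable; first exact: segment_compact.
exact: within_trunc_continuous.
Qed.

Lemma gammaE_cvg s :
  (\int[mu]_(t in trunc_itv 1 n) gamma_fun s t)%:E @[n --> \oo] --> gammaE s.
Proof.
have := @cvg_trunc_integral 1 (gamma_fun s) isT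
  (fun t _ => gamma_fun_ge0 s t) (measurable_gamma_fun s).
apply: cvg_trans; apply: near_eq_cvg; apply: nearW => n.
rewrite /Rintegral fineK //; apply: integrable_fin_num.
  exact: measurable_itv.
by apply: integrable_trunc => t; exact: continuous_gamma_fun.
Qed.

Lemma trunc_by_parts s n :
  \int[mu]_(t in trunc_itv 1 n) gamma_fun (s + 1) t =
  (n.+2%:R^-1 `^ s * expR (- n.+2%:R^-1) - n.+2%:R `^ s * expR (- n.+2%:R)) +
  s * \int[mu]_(t in trunc_itv 1 n) gamma_fun s t.
Proof.
set a := n.+2%:R^-1; set b := n.+2%:R.
have a0 : 0 < a by rewrite invr_gt0.
have b0 : 0 < b :> R by [].
have ab : a < b.
  apply: (@lt_trans _ _ 1); last by rewrite ltr1n.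
  by rewrite invf_lt1 // ltr1n.
have T : trunc_itv 1 n = `[a, b]%classic by rewrite /trunc_itv !expr1.
have pos t : t \in `]a, b[ -> 0 < t.
  by rewrite in_itv /= => /andP[h _]; exact: lt_trans h.
have dG := is_derive_NexpRN.
have := @Rintegration_by_parts R (fun t => t `^ s) (fun t => - expR (- t))
  (fun t => s * t `^ (s - 1)) (fun t => expR (- t)) a b ab.
rewrite -T => H.
transitivity (\int[mu]_(x in trunc_itv 1 n) (x `^ s * expR (- x))).
  by apply: eq_Rintegral => t _; rewrite /gamma_fun addrK.
rewrite H.
- have -> : \int[mu]_(x in trunc_itv 1 n) (s * x `^ (s - 1) * - expR (- x)) =
     - s * \int[mu]_(x in trunc_itv 1 n) gamma_fun s x.
    rewrite -RintegralZl //.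
    + by apply: eq_Rintegral => t _; rewrite /gamma_fun; ring.
    + exact: measurable_itv.
    + by apply: integrable_trunc => t; exact: continuous_gamma_fun.
  by ring.
- apply: within_trunc_continuous => t t0; apply: cvgM; first exact: cvg_cst.
  exact: continuous_powR.
- split.
  + by move=> t /pos t0; apply: derivable_powR; rewrite in_itv /= t0.
  + exact/cvg_at_right_filter/continuous_powR.
  + exact/cvg_at_left_filter/continuous_powR.
- move=> t /pos t0; rewrite powR_derive1 // in_itv /= t0 //.
- by apply: within_trunc_continuous => t t0; exact: continuous_expRN.
- split.
  + by move=> t _; exact: ex_derive.
  + exact/cvg_at_right_filter/continuous_NexpRN.
  + exact/cvg_at_left_filter/continuous_NexpRN.
- by move=> t _; rewrite derive1E derive_val.
Qed.

Lemma cvg_natrV (k : nat) : (n + k.+1)%:R^-1 @[n --> \oo] --> (0 : R).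
Proof.
have := @cvg_harmonic R.
rewrite -(cvg_shiftn k) /harmonic => H; apply: cvg_trans H.
by apply: near_eq_cvg; apply: nearW => n; rewrite /= addnS.
Qed.

Lemma trunc_boundary_cvg s : 0 < s ->
  n.+2%:R^-1 `^ s * expR (- n.+2%:R^-1) - n.+2%:R `^ s * expR (- n.+2%:R)
  @[n --> \oo] --> (0 : R).
Proof.
move=> s0.
have inv0 : n.+2%:R^-1 @[n --> \oo] --> (0 : R).
  by have := cvg_natrV 1; under eq_fun do rewrite addn2.
rewrite -[0 in X in _ --> X](subrr 0); apply: cvgB.
  have pw : n.+2%:R^-1 `^ s @[n --> \oo] --> (0 : R).
    have /cvg_at_rightP := @powR_cvg0 R s s0.
    by apply; split=> // n; rewrite invr_gt0.
  apply: (@squeeze_cvgr _ _ _ _ (fun=> 0) (fun n => n.+2%:R^-1 `^ s)) => //;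
    last exact: cvg_cst.
  apply: nearW => n; rewrite mulr_ge0 ?powR_ge0 ?expR_ge0 //=.
  by rewrite ler_piMr ?powR_ge0 // expR_le1 oppr_le0 invr_ge0.
(* As k >= s and e^b >= b^(k+1) / (k+1)!, the term b^s e^(-b) is at most (k+1)! / b. *)
pose k := (Num.truncn s).+1.
apply: (@squeeze_cvgr _ _ _ _ (fun=> 0) (fun n => k.+1`!%:R * n.+2%:R^-1)).
- apply: nearW => n; rewrite mulr_ge0 ?powR_ge0 ?expR_ge0 //=.
  have b1 : 1 <= n.+2%:R :> R by rewrite ler1n.
  have b0 : 0 < n.+2%:R :> R by [].
  apply: (@le_trans _ _ (n.+2%:R ^+ k * (k.+1`!%:R / n.+2%:R ^+ k.+1))).
    apply: ler_pM; rewrite ?powR_ge0 ?expR_ge0 //.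
      have <- : n.+2%:R `^ k%:R = n.+2%:R ^+ k :> R by rewrite powR_mulrn // ltW.
      by apply: ler_powR => //; apply/ltW/truncnS_gt.
    rewrite expRN -[leRHS]invrK lef_pV2 ?posrE ?expR_gt0 //.
    rewrite invf_div; have := expR_ge1Dxn k (ltW b0); apply: le_trans.
    by rewrite lerDr.
  by rewrite exprS invfM mulrCA [_ ^+ k * _]mulrCA mulfV ?mulr1 // expf_neq0 // gt_eqF.
- exact: cvg_cst.
- by rewrite -[0 in X in _ --> X](mulr0 k.+1`!%:R); apply: cvgM => //; exact: cvg_cst.
Qed.

Lemma gammaES s : 0 < s -> gammaE (s + 1) = (s%:E * gammaE s)%E.
Proof.
move=> s0; rewrite -(cvg_lim _ (gammaE_cvg (s + 1))) //; apply/cvg_lim => //.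
rewrite [X in X @ _ --> _](_ : _ = (fun n : nat =>
  (n.+2%:R^-1 `^ s * expR (- n.+2%:R^-1) - n.+2%:R `^ s * expR (- n.+2%:R))%:E
  + s%:E * (\int[mu]_(t in trunc_itv 1 n) gamma_fun s t)%:E)%E); last first.
  by apply/funext => n; rewrite trunc_by_parts EFinD EFinM.
rewrite -[X in _ --> X]add0e; apply: cvgeD.
- by rewrite ge0_adde_def // ?inE ?lexx // mule_ge0 ?lee_fin ?(ltW s0) //;
    apply: integral_ge0 => t _; rewrite lee_fin gamma_fun_ge0.
- by apply: cvg_EFin; [exact: nearW|exact: trunc_boundary_cvg].
- by apply: cvgeZl => //; exact: gammaE_cvg.
Qed.

Lemma gammaE_ge0 s : (0 <= gammaE s)%E.
Proof. by apply: integral_ge0 => t _; rewrite lee_fin gamma_fun_ge0. Qed.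

Lemma gammaE1 : gammaE 1 = 1%E.
Proof.
rewrite /gammaE integral_itv_obnd_cbnd; last first.
  by apply/measurable_EFinP/measurable_funTS; exact: measurable_gamma_fun.
under eq_integral do rewrite /gamma_fun subrr powRr0 mul1r.
have dG := is_derive_NexpRN.
rewrite (@ge0_continuous_FTC2y R _ (fun t => - expR (- t)) 0 0).
- by rewrite oppr0 expR0 -EFinB opprK add0r.
- by move=> t _; exact: expR_ge0.
- by apply/continuous_subspaceT => t; exact: continuous_expRN.
- by rewrite -[0 in X in _ --> X]oppr0; apply: cvgN; exact: cvgr_expR.
- by move=> t _; exact: ex_derive.
- exact/cvg_at_right_filter/continuous_NexpRN.
- by move=> t _; rewrite derive1E derive_val.
Qed.

(** Pointwise, t^(s2 - 1) is dominated by t^(s1 - 1) for t <= 1 and by t^(s3 - 1) for t > 1.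
    Comparison with the factorials then yields finiteness as well as positivity. *)
Lemma gammaE_between s1 s2 s3 : s1 <= s2 <= s3 ->
  (gammaE s2 <= gammaE s1 + gammaE s3)%E.
Proof.
move=> /andP[h1 h2]; rewrite /gammaE.
have mE := measurable_EFin_gamma_fun.
have pE u t : (0 <= (gamma_fun u t)%:E)%E by rewrite lee_fin gamma_fun_ge0.
rewrite -ge0_integralD //; try exact: mE.
apply: ge0_le_integral => //; try exact: mE.
- by apply: emeasurable_funD; exact: mE.
move=> t /=; rewrite in_itv /= andbT => t0.
rewrite -EFinD lee_fin /gamma_fun -mulrDl ler_wpM2r ?expR_ge0 //.
have [t1|t1] := leP t 1.
  apply: ler_wpDr; first exact: powR_ge0.
  by apply: ger_powR; [rewrite t0|lra].
apply: ler_wpDl; first exact: powR_ge0.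
by apply: ler_powR; [exact: ltW|lra].
Qed.

Lemma gammaE_natr n : gammaE n.+1%:R = (n`!%:R)%:E.
Proof.
elim: n => [|n IH]; first by rewrite gammaE1.
by rewrite -natr1 gammaES // IH -EFinM factS natrM.
Qed.

Lemma gammaE_fin s : 0 < s -> gammaE s \is a fin_num.
Proof.
have ge1 u : 1 <= u -> gammaE u \is a fin_num.
  move=> u1; rewrite ge0_fin_numE ?gammaE_ge0 //.
  have h : 1 <= u <= (Num.truncn u).+1%:R by rewrite u1 ltW // truncnS_gt.
  apply: le_lt_trans (gammaE_between _ _ _ h) _.
  by rewrite gammaE1 gammaE_natr -EFinD ltry.
move=> s0; have := ge1 (s + 1); rewrite lerDr (ltW s0) => /(_ isT).
rewrite gammaES // ge0_fin_numE ?mule_ge0 ?gammaE_ge0 ?lee_fin ?(ltW s0) //.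
rewrite ge0_fin_numE ?gammaE_ge0 // !ltey; apply: contra => /eqP ->.
by rewrite mulry gtr0_sg // mul1e.
Qed.

Lemma gammaE_integral s : 0 < s -> gammaE s = (Gamma_integral s)%:E.
Proof. by move=> s0; rewrite -[LHS]fineK // gammaE_fin. Qed.

Lemma Gamma_integralS s : 0 < s ->
  Gamma_integral (s + 1) = s * Gamma_integral s.
Proof.
move=> s0; apply: EFin_inj; rewrite EFinM -!gammaE_integral //; last by lra.
exact: gammaES.
Qed.

Lemma Gamma_integral_rising s n : 0 < s ->
  Gamma_integral (s + n%:R) = rising s n * Gamma_integral s.
Proof.
move=> s0; elim: n => [|n IH]; first by rewrite addr0 rising0 mul1r.
rewrite risingS -natr1 addrA Gamma_integralS; last by have := ler0n R n; lra.
by rewrite IH; ring.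
Qed.

(** If the value at s were 0, so would be that at s + n + 1, and [gammaE_between] would force n! <=
    0. *)
Lemma Gamma_integral_gt0 s : 0 < s -> 0 < Gamma_integral s.
Proof.
move=> s0; pose n := Num.truncn s.
have h : s <= n.+1%:R <= s + n.+1%:R by rewrite ltW ?truncnS_gt // lerDr (ltW s0).
have := gammaE_between _ _ _ h.
have sn : 0 < s + n.+1%:R by rewrite addr_gt0.
rewrite gammaE_natr !gammaE_integral // Gamma_integral_rising //.
rewrite -EFinD lee_fin => H.
have : 0 <= Gamma_integral s by rewrite -lee_fin -gammaE_integral ?gammaE_ge0.
rewrite le_eqVlt => /predU1P[E|//]; move: H; rewrite -E mulr0 addr0.
by rewrite leNgt ltr0n fact_gt0.
Qed.

(** Integrate sqrt t <= q / 2 + t / (2 q), the arithmetic-geometric mean inequality with q = sqrt s,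
    against t^(s - 1) e^(-t); by the functional equation the two summands on the right contribute
    equally. *)
Lemma Gamma_integral_half s : 0 < s ->
  Gamma_integral (s + 1 / 2) <= Num.sqrt s * Gamma_integral s.
Proof.
move=> s0; set q := Num.sqrt s.
have q0 : 0 < q by rewrite sqrtr_gt0.
have qq : q * q = s by rewrite -expr2 sqr_sqrtr // ltW.
have -> : q * Gamma_integral s =
    q / 2 * Gamma_integral s + (2 * q)^-1 * Gamma_integral (s + 1).
  rewrite Gamma_integralS // -{3}qq; field; exact: lt0r_neq0.
have c1 : 0 <= q / 2 by lra.
have c2 : 0 <= (2 * q)^-1 by rewrite invr_ge0; lra.
have p1 : 0 < s + 1 / 2 by lra.
have p2 : 0 < s + 1 by lra.
have mE := measurable_EFin_gamma_fun.
have pE u t : (0 <= (gamma_fun u t)%:E)%E by rewrite lee_fin gamma_fun_ge0.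
have Z k u : 0 <= k ->
    (k%:E * gammaE u = \int[mu]_(t in `]0%R, +oo[) (k%:E * (gamma_fun u t)%:E))%E.
  by move=> k0; rewrite ge0_integralZl_EFin //; exact: mE.
rewrite -lee_fin EFinD (EFinM (q / 2)) (EFinM (2 * q)^-1) -!gammaE_integral //.
rewrite !Z // /gammaE.
rewrite -ge0_integralD //; try (by apply: measurable_funeM; exact: mE);
  try by move=> t _; rewrite mule_ge0.
apply: ge0_le_integral => //; try exact: mE.
- by apply: emeasurable_funD; apply: measurable_funeM; exact: mE.
  move=> t /=; rewrite in_itv /= andbT => t0.
  rewrite -!EFinM -EFinD lee_fin /gamma_fun !mulrA -mulrDl ler_wpM2r ?expR_ge0 //.
  have tn0 : t != 0 by exact: lt0r_neq0.
  have -> : s + 1 / 2 - 1 = (s - 1) + 2^-1 by lra.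
  have -> : s + 1 - 1 = (s - 1) + 1 by lra.
  move: (s - 1) => v.
  rewrite !powRD ?tn0 ?implybT // powR12_sqrt ?(ltW t0) // powRr1 ?(ltW t0) //.
  set w := t `^ _; have w0 : 0 <= w by exact: powR_ge0.
  have /sqr_sqrtr tt := ltW t0.
  have H := sqr_ge0 (Num.sqrt t - q).
  have -> : q / 2 * w + (2 * q)^-1 * (w * t) =
      w * Num.sqrt t + w * ((Num.sqrt t - q) ^+ 2 / (2 * q)).
    by rewrite -{1}tt; field; exact: lt0r_neq0.
  by rewrite lerDl mulr_ge0 // divr_ge0 //; lra.
Qed.

(** The substitution t = u^2 leads to twice the Gaussian integral over the half-line; it is carried
    out on segments before both sides pass to the limit. *)
Lemma Gamma_integral12 : Gamma_integral (1 / 2) = Num.sqrt pi :> R.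
Proof.
apply: EFin_inj; rewrite -gammaE_integral; last by lra.
have C2 := @cvg_trunc_integral 2 (gamma_fun (1 / 2)) isT
  (fun t _ => gamma_fun_ge0 _ t) (measurable_gamma_fun _).
have mg : measurable_fun setT (fun t : R => 2 * gauss_fun t).
  by apply: measurable_funM => //; exact: measurable_gauss_fun.
have g0 t : 0 < t -> 0 <= 2 * gauss_fun t.
  by move=> _; rewrite mulr_ge0 // gauss_fun_ge0.
have C1 := @cvg_trunc_integral 1 (fun t => 2 * gauss_fun t) isT g0 mg.
have E n : (\int[mu]_(t in trunc_itv 2 n) (gamma_fun (1 / 2) t)%:E =
            \int[mu]_(t in trunc_itv 1 n) (2 * gauss_fun t)%:E)%E.
  rewrite /trunc_itv !expr1 -exprVn; set a := n.+2%:R^-1; set b := n.+2%:R.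
  have a0 : 0 < a by rewrite invr_gt0.
  have ab : a <= b.
    apply: (@le_trans _ _ 1); last by rewrite ler1n.
    by rewrite invf_le1 // ler1n.
  have dF (x : R) : is_derive x 1 (fun t : R => t ^+ 2) (2 * x).
    by apply: is_derive_eq; rewrite /GRing.scale /=; ring.
  have F' : (fun t : R => t ^+ 2)^`()%classic = (fun t => 2 * t).
    by apply/funext => x; rewrite derive1E derive_val.
  have cF (x : R) : {for x, continuous (fun t : R => t ^+ 2)}.
    exact: exprn_continuous.
  have cF' (x : R) : {for x, continuous (fun t : R => 2 * t)}.
    exact: mulrl_continuous.
  rewrite (@integration_by_substitution_increasing R (fun t => t ^+ 2)
    (gamma_fun (1 / 2)) a b ab).
  - apply: eq_integral => t; rewrite inE /= in_itv /= => /andP[ta _].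
    have t0 : 0 < t by exact: lt_le_trans ta.
    rewrite F' !fctE /gamma_fun /gauss_fun /=.
    have -> : (t ^+ 2) `^ (1 / 2 - 1) = t^-1.
      have -> : 1 / 2 - 1 = - 2^-1 :> R by lra.
      by rewrite powRN powR12_sqrt ?sqr_ge0 // sqrtr_sqr gtr0_norm.
    by congr EFin; field; exact: lt0r_neq0.
  - move=> x y; rewrite !in_itv /= => /andP[xa _] /andP[ya _] xy.
    by rewrite ltrXn2r ?nnegrE //; apply: ltW; apply: lt_le_trans a0 _.
  - by rewrite F' => x _; exact: cF'.
  - by rewrite F'; apply/cvg_ex; exists (2 * a); exact/cvg_at_right_filter/cF'.
  - by rewrite F'; apply/cvg_ex; exists (2 * b); exact/cvg_at_left_filter/cF'.
  - split.
    + by move=> x _; exact: ex_derive.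
    + exact/cvg_at_right_filter/cF.
    + exact/cvg_at_left_filter/cF.
  - apply/subspace_continuousP => t /=; rewrite in_itv /= => /andP[ta _].
    apply: cvg_within_filter; apply: continuous_gamma_fun.
    by apply: lt_le_trans ta; rewrite exprn_gt0.
rewrite /gammaE -(cvg_lim _ C2) // (funext E) (cvg_lim _ C1) //.
rewrite integral_itv_obnd_cbnd; last first.
  by apply/measurable_EFinP/measurable_funTS.
under eq_integral do rewrite EFinM.
rewrite ge0_integralZl_EFin //.
- by rewrite integral0y_gauss -EFinM mulrCA divff // mulr1.
- by move=> t _; rewrite lee_fin gauss_fun_ge0.
- by apply/measurable_EFinP/measurable_funTS; exact: measurable_gauss_fun.
Qed.

End Trunc.

(** * Raabe ratios and Gamma quotients *)

Section Raabe.
Context {R : realType}.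
Implicit Types (a b : R) (rho u : nat -> R).

Lemma near_natr_gt b : \forall n \near \oo, b < n%:R.
Proof.
exists (Num.truncn b).+1 => // n /= h.
by apply: (lt_le_trans (truncnS_gt b)); rewrite ler_nat.
Qed.

Lemma cvg_natr_ratio a b : (n%:R + a) / (n%:R + b) @[n --> \oo] --> (1 : R).
Proof.
have C c : 1 + (c - 1) * n.+1%:R^-1 @[n --> \oo] --> (1 : R).
  rewrite -[X in _ --> X]addr0; apply: cvgD; first exact: cvg_cst.
  rewrite -[X in _ --> X](mulr0 (c - 1)); apply: cvgM; first exact: cvg_cst.
  exact: cvg_harmonic.
have H : (1 + (a - 1) * n.+1%:R^-1) / (1 + (b - 1) * n.+1%:R^-1)
    @[n --> \oo] --> (1 : R).
  rewrite -[X in _ --> X](divr1 1); apply: cvgM => //.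
  by apply: cvgV; [exact: oner_neq0|exact: C].
apply: cvg_trans H; apply: near_eq_cvg; apply: nearW => n.
have E (c : R) : n%:R + c = n.+1%:R * (1 + (c - 1) * n.+1%:R^-1).
  by rewrite -natr1; field; rewrite natr1 pnatr_eq0.
by rewrite !E -mulf_div divff ?mul1r ?pnatr_eq0.
Qed.

(* Raabe's calculus: [rho n = 1 + a / n + o(1 / n)]. *)
Definition raabe a rho := n%:R * (rho n - 1) @[n --> \oo] --> a.

Lemma raabe_cvg1 a rho : raabe a rho -> rho @ \oo --> (1 : R).
Proof.
rewrite /raabe -cvg_shiftS -(cvg_shiftS rho) => H.
have : 1 + n.+1%:R * (rho n.+1 - 1) * harmonic n @[n --> \oo] --> 1 + a * 0.
  by apply: cvgD; [exact: cvg_cst|exact: cvgM H (@cvg_harmonic R)].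
rewrite mulr0 addr0; apply: cvg_trans; apply: near_eq_cvg; apply: nearW => n /=.
by rewrite mulrAC divff ?pnatr_eq0 // mul1r addrC subrK.
Qed.

Lemma raabeM a b rho sigma : raabe a rho -> raabe b sigma ->
  raabe (a + b) (fun n => rho n * sigma n).
Proof.
move=> Ha Hb; have H1 := raabe_cvg1 _ _ Hb.
have : n%:R * (rho n - 1) * sigma n + n%:R * (sigma n - 1) @[n --> \oo]
    --> a * 1 + b by apply: cvgD => //; exact: cvgM.
rewrite mulr1; apply: cvg_trans.
by apply: near_eq_cvg; apply: nearW => n; ring.
Qed.

Lemma raabe_ratio a b : raabe (a - b) (fun n => (n%:R + a) / (n%:R + b)).
Proof.
have : (a - b) * ((n%:R + 0) / (n%:R + b)) @[n --> \oo] --> (a - b) * 1.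
  by apply: cvgM; [exact: cvg_cst|exact: cvg_natr_ratio].
rewrite mulr1; apply: cvg_trans; apply: near_eq_cvg.
have := near_natr_gt (- b); apply: filterS => n h.
by rewrite addr0; field; rewrite gt_eqF //; lra.
Qed.

Lemma natrV_powR_cvg0 a : 0 < a -> n%:R^-1 `^ a @[n --> \oo] --> (0 : R).
Proof.
move=> a0; rewrite -cvg_shiftS /=.
have /cvg_at_rightP := powR_cvg0 a0; apply; split => //.
exact: cvg_harmonic.
Qed.

(** Comparison with n^(-b): eventually rho n <= 1 - b / n <= exp(- b / n) <= (n / (n + 1))^b, the
    last step by ln (1 + 1 / n) <= 1 / n. Taking b = - a / 2 leaves room for the o(1 / n). *)
Lemma raabe_cvg0 a rho u : a < 0 -> raabe a rho ->
  (\forall n \near \oo, u n.+1 = rho n * u n) -> u @ \oo --> (0 : R).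
Proof.
move=> a0 Hr Hu; pose b := - a / 2.
have b0 : 0 < b by rewrite /b; lra.
have H1 : \forall n \near \oo, n%:R * (rho n - 1) < - b.
  by apply: (cvgr_lt a Hr); rewrite /b; lra.
have H2 : \forall n \near \oo, 0 < rho n.
  by apply: (cvgr_gt _ (raabe_cvg1 _ _ Hr)); exact: ltr01.
have [N _ HN] : \forall n \near \oo, [/\ u n.+1 = rho n * u n, 0 < rho n,
    n%:R * (rho n - 1) < - b & 0 < n%:R :> R].
  by near=> n; split; near: n => //; exact: near_natr_gt.
have {HN} HN n : (N <= n)%N -> [/\ u n.+1 = rho n * u n, 0 < rho n,
    n%:R * (rho n - 1) < - b & 0 < n%:R :> R] by exact: HN.
pose w n : R := n%:R^-1 `^ b.
have w0 n : (N <= n)%N -> 0 < w n.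
  by case/HN => *; rewrite powR_gt0 // invr_gt0.
pose c := `|u N| / w N.
have key n : (N <= n)%N -> `|u n| <= c * w n.
  move=> /subnKC <-; elim: (n - N)%N => [|k IH].
    by rewrite addn0 /c divfK // gt_eqF // w0.
  rewrite addnS; set j := (N + k)%N in IH *.
  have [-> r0 r1 j0] := HN j (leq_addr _ _).
  have c0 : 0 <= c by rewrite divr_ge0 // ltW // w0.
  rewrite normrM (gtr0_norm r0).
  have rj : rho j <= expR (- b / j%:R).
    apply: le_trans (expR_ge1Dx _).
    by rewrite -lerBlDl ler_pdivlMr // mulrC ltW.
  apply: (le_trans (ler_pM (ltW r0) (normr_ge0 _) rj IH)).
  rewrite mulrCA ler_wpM2l // /w.
  have E (m : nat) : 0 < m%:R :> R -> m%:R^-1 `^ b = expR (- b * ln m%:R).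
    by move=> m0; rewrite /powR invr_eq0 gt_eqF // lnV ?posrE // mulrN mulNr.
  rewrite !E // -expRD ler_expR -mulrDr !mulNr lerN2 ler_pM2l //.
  rewrite -lerBlDr -ln_div ?posrE //.
  have -> : j.+1%:R / j%:R = 1 + j%:R^-1 :> R.
    by rewrite -natr1 mulrDl divff ?gt_eqF // mul1r.
  by apply: le_ln1Dx; apply: (lt_trans (ltrN10 _)); rewrite invr_gt0.
have C : c * w n @[n --> \oo] --> (0 : R).
  rewrite -[X in _ --> X](mulr0 c); apply: cvgM; first exact: cvg_cst.
  exact: natrV_powR_cvg0.
apply/norm_cvg0P; apply: (squeeze_cvgr _ (cvg_cst 0) C).
by exists N => // n /= /key h; rewrite normr_ge0.
Unshelve. all: by end_near. Qed.

End Raabe.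

Section GammaRatio.
Context {R : realType}.
Implicit Types (l s x : R).

Lemma Gamma_gt0E s : 0 < s -> Gamma s = Gamma_integral s.
Proof.
move=> s0; rewrite /Gamma; have -> : Num.truncn (1 - s) = 0%N.
  by apply/eqP; rewrite -leqn0 truncn_le_nat; lra.
by rewrite addr0 rising0 divr1.
Qed.

(** For negative l the shift in the definition of [Gamma] is k = 1, so the equation holds by
    definition; for positive l it is the functional equation. *)
Lemma mulr_Gamma l : - (1 / 2) < l -> l != 0 ->
  l * Gamma l = Gamma_integral (l + 1).
Proof.
move=> l12 ln0; have [l0|l0] := ltP 0 l.
  by rewrite Gamma_gt0E // Gamma_integralS.
rewrite /Gamma; have -> : Num.truncn (1 - l) = 1%N.
  by apply: truncn_def; rewrite -[2]/(1 + 1); apply/andP; split; lra.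
by rewrite risingS rising0 mul1r addr0 mulrC divfK.
Qed.

Definition gamma_quot x := Gamma_integral (x + 1 / 2) / Gamma_integral x.

Lemma gamma_quot_gt0 x : 0 < x -> 0 < gamma_quot x.
Proof. by move=> x0; rewrite divr_gt0 // Gamma_integral_gt0 //; lra. Qed.

Lemma gamma_quot_sqr_le x : 0 < x -> gamma_quot x ^+ 2 <= x.
Proof.
move=> x0; have := Gamma_integral_half x x0.
rewrite -ler_pdivrMr ?Gamma_integral_gt0 // -/(gamma_quot x) => H.
have q0 := ltW (gamma_quot_gt0 x x0).
by rewrite -[leRHS]sqr_sqrtr ?(ltW x0) // lerXn2r ?nnegrE // sqrtr_ge0.
Qed.

Lemma gamma_quot_mul x : 0 < x -> gamma_quot x * gamma_quot (x + 1 / 2) = x.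
Proof.
move=> x0; rewrite /gamma_quot -addrA.
have -> : 1 / 2 + 1 / 2 = 1 :> R by lra.
rewrite Gamma_integralS //; field.
by apply/andP; split; rewrite gt_eqF // Gamma_integral_gt0 //; lra.
Qed.

(** The upper bound at x + 1/2 becomes a lower bound at x, because the two quotients multiply to
    x. *)
Lemma gamma_quot_sqr_ge x : 0 < x -> x ^+ 2 / (x + 1 / 2) <= gamma_quot x ^+ 2.
Proof.
move=> x0; have x2 : 0 < x + 1 / 2 by lra.
rewrite ler_pdivrMr // -{1}(gamma_quot_mul x x0) exprMn ler_pM2l.
  exact: gamma_quot_sqr_le.
by rewrite exprn_gt0 // gamma_quot_gt0.
Qed.

Lemma ratio_squeeze (A B v w : R) : 0 < v -> 0 < w -> 0 < B ->
  A <= v -> v ^+ 2 / (v + 1 / 2) <= A -> B <= w -> w ^+ 2 / (w + 1 / 2) <= B ->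
  v / (v + 1 / 2) * (v / w) <= A / B <= v / w * ((w + 1 / 2) / w).
Proof.
move=> v0 w0 B0 Av vA Bw wB.
have v2 : 0 < v + 1 / 2 by lra.
have w2 : 0 < w + 1 / 2 by lra.
rewrite ler_pdivlMr // ler_pdivrMr //; apply/andP; split.
  apply: le_trans vA; rewrite -[leRHS]mulr1.
  have -> : v / (v + 1 / 2) * (v / w) * B = v ^+ 2 / (v + 1 / 2) * (B / w).
    by field; apply/andP; split; rewrite gt_eqF //; lra.
  rewrite ler_wpM2l ?ler_pdivrMr ?mul1r //.
  by apply: divr_ge0; [exact: sqr_ge0|lra].
apply: (le_trans Av).
have {1}-> : v = v / w * ((w + 1 / 2) / w) * (w ^+ 2 / (w + 1 / 2)).
  by field; apply/andP; split; rewrite gt_eqF //; lra.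
by rewrite ler_wpM2l // mulr_ge0 //; apply: divr_ge0; lra.
Qed.

Lemma gamma_quot_ratio_cvg x y : 0 < x -> 0 < y ->
  gamma_quot (x + n%:R) / gamma_quot (y + n%:R) @[n --> \oo] --> (1 : R).
Proof.
move=> x0 y0; pose q n := gamma_quot (x + n%:R) / gamma_quot (y + n%:R).
have xn n : 0 < x + n%:R by have := ler0n R n; lra.
have yn n : 0 < y + n%:R by have := ler0n R n; lra.
have q0 n : 0 <= q n by rewrite divr_ge0 // ltW // gamma_quot_gt0.
have Q : q n ^+ 2 @[n --> \oo] --> (1 : R).
  have L : (n%:R + x) / (n%:R + (x + 1 / 2)) * ((n%:R + x) / (n%:R + y))
      @[n --> \oo] --> (1 : R).
    rewrite -[X in _ --> X](mulr1 1); apply: cvgM; exact: cvg_natr_ratio.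
  have U : (n%:R + x) / (n%:R + y) * ((n%:R + (y + 1 / 2)) / (n%:R + y))
      @[n --> \oo] --> (1 : R).
    rewrite -[X in _ --> X](mulr1 1); apply: cvgM; exact: cvg_natr_ratio.
  apply: (squeeze_cvgr _ L U); apply: nearW => n.
  have X1 := gamma_quot_sqr_le _ (xn n); have X2 := gamma_quot_sqr_ge _ (xn n).
  have Y1 := gamma_quot_sqr_le _ (yn n); have Y2 := gamma_quot_sqr_ge _ (yn n).
  have gx := gamma_quot_gt0 _ (xn n); have gy := gamma_quot_gt0 _ (yn n).
  have nx := xn n; have ny := yn n.
  rewrite /q expr_div_n !addrA ![n%:R + _]addrC.
  have B0 : 0 < gamma_quot (y + n%:R) ^+ 2 by rewrite exprn_gt0.
  exact: ratio_squeeze nx ny B0 X1 X2 Y1 Y2.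
have : Num.sqrt (q n ^+ 2) @[n --> \oo] --> (Num.sqrt 1 : R).
  by apply: continuous_cvg Q; exact: sqrt_continuous.
rewrite sqrtr1; apply: cvg_trans; apply: near_eq_cvg; apply: nearW => n /=.
by rewrite sqrtr_sqr ger0_norm.
Qed.

(** Up to constants, (1 + l)_n / (l + 1/2)_n is [gamma_quot] at l + 1/2 + n, and (3/2)_n / (2)_n is
    the inverse of [gamma_quot] at 3/2 + n. The square root of pi enters through Gamma(3/2). *)
Lemma Gamma_quot_cvg l : - (1 / 2) < l -> l != 0 ->
  l * (rising (1 + l) n * rising (3 / 2) n /
       (rising 2 n * rising (l + 1 / 2) n)) @[n --> \oo] -->
  2 * Gamma (l + 1 / 2) / (Num.sqrt pi * Gamma l).
Proof.
move=> l12 ln0.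
have p1 : 0 < l + 1 / 2 by lra.
have p2 : 0 < 1 + l by lra.
have p32 : 0 < 3 / 2 :> R by lra.
have p20 : 0 < 2 :> R by lra.
have p12 : 0 < 1 / 2 :> R by lra.
have e32 : 3 / 2 = 1 / 2 + 1 :> R by lra.
have e1 n : l + 1 / 2 + n%:R + 1 / 2 = (1 + l) + n%:R by lra.
have e2 n : 3 / 2 + n%:R + 1 / 2 = 2 + n%:R :> R by lra.
have r1 n : rising 2 n != 0 :> R by apply: rising_neq0 => //; lra.
have r2 n : rising (l + 1 / 2) n != 0 by apply: rising_neq0; lra.
have r3 n : rising (3 / 2) n != 0 :> R by apply: rising_neq0; lra.
have G1 := Gamma_integral_gt0 _ p1; have G2 := Gamma_integral_gt0 _ p2.
have sp : 0 < Num.sqrt pi :> R by rewrite sqrtr_gt0 pi_gt0.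
have lG : l * Gamma l = Gamma_integral (1 + l) by rewrite [1 + l]addrC mulr_Gamma.
have Gn0 : Gamma l != 0.
  by apply: contraTneq G2 => E; rewrite -lG E mulr0 ltxx.
have G32 : Gamma_integral (3 / 2) = Num.sqrt pi / 2 :> R.
  by rewrite e32 Gamma_integralS // Gamma_integral12; ring.
have GI1 : Gamma_integral 1 = 1 :> R.
  by apply: EFin_inj; rewrite -gammaE_integral // gammaE1.
have G2' : Gamma_integral 2 = 1 :> R.
  by rewrite -[2]/(1 + 1) Gamma_integralS // GI1 mulr1.
rewrite Gamma_gt0E //.
set c := _ / (_ * Gamma l).
have : c * (gamma_quot (l + 1 / 2 + n%:R) / gamma_quot (3 / 2 + n%:R))
    @[n --> \oo] --> c * 1.
  by apply: cvgM; [exact: cvg_cst|exact: gamma_quot_ratio_cvg].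
rewrite mulr1; apply: cvg_trans.
apply: near_eq_cvg; apply: nearW => n; rewrite /gamma_quot /c.
rewrite e1 e2 !Gamma_integral_rising // G32 G2' -lG.
field.
by rewrite ?Gn0 ?ln0 ?r1 ?r2 ?r3 ?gt_eqF.
Qed.

End GammaRatio.

(** * A well-poised sum *)

Section WellPoised.
Context {R : realType}.
Implicit Types (l : R) (t b sigma : nat -> R).

(** Leibniz's estimate. Writing the sum as s times its first term, where prepending a term replaces
    s by 1 - sigma_M s, avoids a case distinction on signs. *)
Lemma alternating_sum_bound b sigma M K : (M < K)%N ->
  (forall n, (M <= n < K)%N -> b n.+1 = - (sigma n * b n)) ->
  (forall n, (M <= n < K)%N -> 0 <= sigma n <= 1) ->
  `|\sum_(M <= n < K) b n| <= `|b M|.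
Proof.
move=> MK bS s01.
suff [s /andP[s0 s1] ->] : exists2 s, 0 <= s <= 1 & \sum_(M <= n < K) b n = s * b M.
  by rewrite normrM (ger0_norm s0) ler_piMl.
have [k Kk] : exists k, K = (M + k.+1)%N by exists (K - M).-1; lia.
elim: k M Kk MK bS s01 => [|k IH] M Kk MK bS s01.
  by exists 1; [rewrite ler01 lexx|rewrite Kk addn1 big_nat1 mul1r].
have /andP[s0 s1] : 0 <= sigma M <= 1 by apply: s01; lia.
have [||||s /andP[r0 r1] E] := IH M.+1; [lia|lia|..].
- by move=> n hn; apply: bS; lia.
- by move=> n hn; apply: s01; lia.
exists (1 - sigma M * s).
  have : sigma M * s <= 1 by rewrite mulr_ile1.
  have : 0 <= sigma M * s by rewrite mulr_ge0.
  by move=> *; apply/andP; split; lra.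
by rewrite big_ltn // E bS; [ring|lia].
Qed.

(* [(-1)^n (-N)_n / (l + 1 + N)_n], which tends to 1 as [N] grows. *)
Definition wp_weight l (N n : nat) : R :=
  \prod_(0 <= j < n) ((N%:R - j%:R) / (l + 1 + N%:R + j%:R)).

(** Dougall's product (1+a)_N (1+a-b-c)_N / ((1+a-b)_N (1+a-c)_N) for the terminating well-poised
    5F4, at a = l, b = l - 1, c = 1/2. *)
Definition wp_value l (N : nat) : R :=
  rising (1 + l) N * rising (3 / 2) N / (rising 2 N * rising (l + 1 / 2) N).

Lemma wp_weight0 l N : wp_weight l N 0 = 1.
Proof. by rewrite /wp_weight big_geq. Qed.

Lemma wp_weightS l N n : wp_weight l N n.+1 =
  wp_weight l N n * ((N%:R - n%:R) / (l + 1 + N%:R + n%:R)).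
Proof. by rewrite /wp_weight big_nat_recr. Qed.

(** Directed from N + 1 to N, since the inverse relation would divide by N + 1 - n, which is 0 at n
    = N + 1. *)
Lemma wp_weight_succ l N n : -1 < l ->
  wp_weight l N n = wp_weight l N.+1 n * ((N%:R + 1 - n%:R) *
    (l + 1 + N%:R + n%:R) / ((N%:R + 1) * (l + 1 + N%:R))).
Proof.
move=> l1; have N0 := ler0n R N.
elim: n => [|n IH].
  by rewrite !wp_weight0; field; apply/andP; split; rewrite gt_eqF //; lra.
have n0 := ler0n R n.
rewrite !wp_weightS IH -!natr1; field.
by do !(apply/andP; split); rewrite gt_eqF //; lra.
Qed.

Lemma wp_weight_ge0_le1 l N n : -1 < l -> (n <= N.+1)%N ->
  0 <= wp_weight l N n <= 1.
Proof.
move=> l1; elim: n => [|n IH] nN; first by rewrite wp_weight0 ler01 lexx.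
have /andP[w0 w1] := IH (ltnW nN).
have nN' : n%:R <= N%:R :> R by rewrite ler_nat -ltnS.
have n0 := ler0n R n.
have d0 : 0 < l + 1 + N%:R + n%:R by lra.
have q0 : 0 <= (N%:R - n%:R) / (l + 1 + N%:R + n%:R).
  by rewrite divr_ge0 //; lra.
have q1 : (N%:R - n%:R) / (l + 1 + N%:R + n%:R) <= 1.
  by rewrite ler_pdivrMr // mul1r; lra.
by rewrite wp_weightS mulr_ge0 // mulr_ile1.
Qed.

Lemma wp_weight_cvg l n : wp_weight l N n @[N --> \oo] --> (1 : R).
Proof.
elim: n => [|n IH].
  by rewrite (funext (fun N => wp_weight0 l N)); exact: cvg_cst.
rewrite (funext (fun N => wp_weightS l N n)).
rewrite -[X in _ --> X](mulr1 1); apply: cvgM => //.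
have := cvg_natr_ratio (- n%:R) (l + 1 + n%:R).
apply: cvg_trans; apply: near_eq_cvg; apply: nearW => N.
by congr (_ / _); ring.
Qed.

(* The ratios of consecutive terms of the series with terms
   [(-1)^n (l + 2 n) (l)_n (l - 1)_n (1/2)_n / (n! (2)_n (l + 1/2)_n)]. *)
Definition wp_rec l t := forall n : nat,
  t n.+1 * ((l + 2 * n%:R) * (n%:R + 1) * (n%:R + 2) * (n%:R + l + 1 / 2)) =
  - ((l + 2 * n%:R + 2) * (n%:R + l - 1) * (n%:R + l) * (n%:R + 1 / 2) * t n).

(* Wilf-Zeilberger: the summands of the sums for [N] and [N.+1], normalised by
   [wp_value], differ by the difference in [M] of the right-hand side. *)
Lemma wp_telescope l t N M : - (1 / 2) < l -> l != 0 -> wp_rec l t ->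
  \sum_(0 <= n < M) t n * wp_weight l N.+1 n *
      ((N%:R + 2) * (N%:R + l + 1 / 2) / ((1 + l + N%:R) * (N%:R + 3 / 2))) -
  \sum_(0 <= n < M) t n * wp_weight l N n =
  - (M%:R * (M%:R + 1) * (M%:R + l - 1 / 2) * (l + 1 + N%:R + M%:R)
     / ((N%:R + 3 / 2) * (l + 2 * M%:R) * (N%:R + 1) * (l + 1 + N%:R))
     * (t M * wp_weight l N.+1 M)).
Proof.
move=> l12 l0 trec.
have l1 : -1 < l by lra.
have N0 := ler0n R N.
elim: M => [|M IH]; first by rewrite !big_geq //; ring.
have M0 := ler0n R M.
have lM : l + 2 * M%:R != 0.
  case: (M) => [|k]; first by rewrite mulr0 addr0.
  by rewrite gt_eqF // -natr1; have := ler0n R k; lra.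
have d1 : 0 < M%:R + 2 :> R by lra.
have d2 : 0 < M%:R + l + 1 / 2 by lra.
have d3 : 0 < l + 1 + N%:R by lra.
have d4 : 0 < l + 1 + N%:R + M%:R + 1 by lra.
have d5 : 0 < M%:R + 1 :> R by lra.
have d6 : 0 < l + 2 * M%:R + 2 by lra.
have -> : t M.+1 = - ((l + 2 * M%:R + 2) * (M%:R + l - 1) * (M%:R + l) *
   (M%:R + 1 / 2) * t M) /
   ((l + 2 * M%:R) * (M%:R + 1) * (M%:R + 2) * (M%:R + l + 1 / 2)).
  by rewrite -trec mulfK // !mulf_neq0 // gt_eqF.
rewrite !(big_nat_recr M) //= opprD addrACA IH wp_weightS (wp_weight_succ l N M l1).
rewrite -!natr1; field.
by rewrite lM; do !(apply/andP; split); rewrite // gt_eqF //; lra.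
Qed.

Lemma wp_finite_sum l t N : - (1 / 2) < l -> l != 0 -> wp_rec l t ->
  \sum_(0 <= n < N.+1) t n * wp_weight l N n = t 0%N * wp_value l N.
Proof.
move=> l12 l0 trec; elim: N => [|N IH].
  by rewrite big_nat1 wp_weight0 /wp_value !rising0; field.
have N0 := ler0n R N.
(* At M = N + 2 both sums are complete and the weight on the right-hand side is 0, so the sum
   divided by [wp_value] does not depend on N. *)
have := wp_telescope l t N N.+2 l12 l0 trec.
have -> : wp_weight l N.+1 N.+2 = 0 by rewrite wp_weightS subrr mul0r mulr0.
rewrite !mulr0 oppr0 -mulr_suml => /subr0_eq.
rewrite [X in _ = X](big_nat_recr N.+1) //= IH wp_weightS subrr mul0r !mulr0 addr0.
have c0 : (N%:R + 2) * (N%:R + l + 1 / 2) / ((1 + l + N%:R) * (N%:R + 3 / 2)) != 0.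
  by rewrite !(mulf_neq0, invr_neq0) // gt_eqF //; lra.
move=> H; apply: (mulIf c0); rewrite H /wp_value !risingS.
have r1 : rising 2 N != 0 :> R by apply: rising_neq0 => //; lra.
have r2 : rising (l + 1 / 2) N != 0 by apply: rising_neq0; lra.
field; rewrite r1 r2.
by do !(apply/andP; split); rewrite // gt_eqF //; lra.
Qed.

Definition wp_ratio l (n : nat) : R :=
  (n%:R + (l / 2 + 1)) / (n%:R + l / 2) * ((n%:R + (l - 1)) / (n%:R + 2)) *
  ((n%:R + l) / (n%:R + 1)) * ((n%:R + 1 / 2) / (n%:R + (l + 1 / 2))).

Lemma wp_ratioE l t n : - (1 / 2) < l -> l != 0 -> wp_rec l t ->
  t n.+1 = - (wp_ratio l n * t n).
Proof.
move=> l12 l0 /(_ n) H.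
have n0 := ler0n R n.
have ln : l + 2 * n%:R != 0.
  case: (n) => [|k]; first by rewrite mulr0 addr0.
  by rewrite gt_eqF // -natr1; have := ler0n R k; lra.
have d : (l + 2 * n%:R) * (n%:R + 1) * (n%:R + 2) * (n%:R + l + 1 / 2) != 0.
  by rewrite !mulf_neq0 // gt_eqF //; lra.
have ln' : n%:R + l / 2 != 0.
  by apply: contra ln => /eqP h; apply/eqP; lra.
apply: (mulIf d); rewrite H /wp_ratio; field.
have ln'' : n%:R * 2 + l != 0 by rewrite mulrC addrC.
by rewrite ?ln''; do !(apply/andP; split); rewrite // gt_eqF //; lra.
Qed.

(** Every linear quotient contributes the difference of its shifts; the total is negative precisely
    for l < 3. *)
Lemma raabe_wp_ratio l : raabe (l - 3) (wp_ratio l).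
Proof.
have -> : l - 3 = (l / 2 + 1 - l / 2) + (l - 1 - 2) + (l - 1) +
  (1 / 2 - (l + 1 / 2)) by lra.
apply: raabeM (raabe_ratio _ _); apply: raabeM (raabe_ratio _ _).
exact: raabeM (raabe_ratio _ _) (raabe_ratio _ _).
Qed.

(* The finite sums are damped versions of the series with weights decreasing
   in [n]; since the terms alternate, [t M] bounds all the remainders at once. *)
Lemma wp_series_cvg l t (L : R) : - (1 / 2) < l < 3 -> l != 0 -> wp_rec l t ->
  (t 0%N * wp_value l N @[N --> \oo] --> L) -> series t @ \oo --> L.
Proof.
move=> /andP[l12 l3] l0 trec HL.
have l1 : -1 < l by lra.
have Hr := raabe_wp_ratio l.
have tS n := wp_ratioE l t n l12 l0 trec.
have t0 : t @ \oo --> (0 : R).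
  have u0 : (fun n => (-1) ^+ n * t n) @ \oo --> (0 : R).
    apply: (raabe_cvg0 (l - 3) _ _ _ Hr); first by lra.
    by apply: nearW => n; rewrite tS exprS; ring.
  apply/cvgrPdist_le => e e0; move/cvgrPdist_le: u0 => /(_ e e0).
  by apply: filterS => n; rewrite !sub0r !normrN normrM normrX normrN1 expr1n mul1r.
have [N0 _ HN0] : \forall n \near \oo, 0 <= wp_ratio l n <= 1.
  have H1 : \forall n \near \oo, n%:R * (wp_ratio l n - 1) < 0.
    by apply: (cvgr_lt _ Hr); lra.
  have H2 : \forall n \near \oo, 0 < wp_ratio l n.
    by apply: (cvgr_gt _ (raabe_cvg1 _ _ Hr)); exact: ltr01.
  near=> n; apply/andP; split; first by apply: ltW; near: n.
  have n0 : 0 < n%:R :> R by near: n; exact: near_natr_gt.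
  have : n%:R * (wp_ratio l n - 1) < 0 by near: n.
  by rewrite pmulr_rlt0 // subr_lt0 => /ltW.
(* M stays fixed while N tends to infinity: only finitely many weights have to converge, and the
   bound on the remainder is independent of N. *)
have key M : (N0 <= M)%N -> `|series t M - L| <= `|t M|.
  move=> NM.
  have C : `|\sum_(0 <= n < M) t n * wp_weight l N n - t 0%N * wp_value l N|
      @[N --> \oo] --> `|series t M - L|.
    apply: cvg_norm; apply: cvgB.
      rewrite /series /=; elim: (M) => [|k IH].
        rewrite big_geq // [X in X @ _](_ : _ = fun=> 0); first exact: cvg_cst.
        by apply/funext => N; rewrite big_geq.
      rewrite big_nat_recr // [X in X @ _](_ : _ = fun N =>
        \sum_(0 <= n < k) t n * wp_weight l N n + t k * wp_weight l N k) /=;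
        last by apply/funext => N; rewrite big_nat_recr.
      apply: cvgD => //.
      rewrite -[X in _ --> X]mulr1; apply: cvgM; first exact: cvg_cst.
      exact: wp_weight_cvg.
    exact: HL.
  rewrite -(cvg_lim _ C) //; apply: limr_le; first by apply/cvg_ex; eexists; exact: C.
  exists M => // N /= MN.
  rewrite -(wp_finite_sum l t N l12 l0 trec).
  have lM : (M <= N.+1)%N by exact: leqW.
  rewrite [in X in _ - X](@big_cat_nat _ _ _ M) //= opprD addrA subrr add0r normrN.
  apply: (@le_trans _ _ `|t M * wp_weight l N M|).
    apply: (alternating_sum_bound _ (fun n => wp_ratio l n *
      ((N%:R - n%:R) / (l + 1 + N%:R + n%:R)))) => //.
    - by move=> n _; rewrite tS wp_weightS; ring.
    - move=> n /andP[Mn nN].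
      have /andP[r0 r1] := HN0 n (leq_trans NM Mn).
      have nN' : n%:R <= N%:R :> R by rewrite ler_nat -ltnS.
      have n0 := ler0n R n.
      have d0 : 0 < l + 1 + N%:R + n%:R by lra.
      have q0 : 0 <= (N%:R - n%:R) / (l + 1 + N%:R + n%:R).
        by rewrite divr_ge0 //; lra.
      have q1 : (N%:R - n%:R) / (l + 1 + N%:R + n%:R) <= 1.
        by rewrite ler_pdivrMr // mul1r; lra.
      by rewrite mulr_ge0 // mulr_ile1.
  have /andP[w0 w1] := wp_weight_ge0_le1 l N M l1 lM.
  by rewrite normrM (ger0_norm w0) ler_piMr.
apply/cvgrPdist_le => e e0.
move/cvgrPdist_le: t0 => /(_ e e0) [N1 _ HN1].
exists (maxn N0 N1) => // M /=; rewrite geq_max => /andP[h0 h1].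
rewrite distrC; apply: (le_trans (key M h0)).
by have := HN1 M h1; rewrite /= sub0r normrN.
Unshelve. all: by end_near. Qed.

End WellPoised.

(** * Partial sums of the expansion *)

Section Expansion.
Context {R : realType}.
Context (l : R).
Context (l12 : - (1 / 2) < l).
Context (l0 : l != 0).
Implicit Types (x r : R) (m n N k : nat).

Definition geg_coef m n : R :=
  (m%:R + 1) / (m%:R + n%:R + 1) * (rbinom (l - 1) n * rbinom l (m + n)).

(* [C_k(x) / C_k(1)]. *)
Definition ngeg x k : R := geg l x k / rbinom (2 * l) k.

(* [m + 1] times a partial sum of the series. *)
Definition geg_psum m N x : R :=
  \sum_(0 <= n < N) geg_coef m n * (l + m%:R + 2 * n%:R) * ngeg x (m + 2 * n).

Lemma natrS k : k.+1%:R = k%:R + 1 :> R. Proof. by rewrite natr1. Qed.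
Lemma mul2_gtN1 : -1 < 2 * l. Proof. by have := l12; lra. Qed.
Lemma mul2_neq0 : 2 * l != 0. Proof. by rewrite mulf_neq0. Qed.
Lemma addl_natr_neq0 k : l + k%:R != 0.
Proof.
have L12 := l12.
case: k => [|k]; first by rewrite addr0.
by rewrite gt_eqF // natrS; have := ler0n R k; lra.
Qed.
Lemma mul2_addl_natr_neq0 k : 2 * l + k%:R != 0.
Proof.
have L12 := l12.
case: k => [|k]; first by rewrite addr0 mul2_neq0.
by rewrite gt_eqF // (natrS k); have := ler0n R k; lra.
Qed.

Lemma ngeg_rec x k : 2 * x * (l + k%:R + 1) * ngeg x k.+1 =
  (k%:R + 1 + 2 * l) * ngeg x k.+2 + (k%:R + 1) * ngeg x k.
Proof.
have L12 := l12.
have k0 := ler0n R k.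
have h0 := mul2_addl_natr_neq0 k; have h1 := mul2_addl_natr_neq0 k.+1.
have b := rbinom_neq0 _ k mul2_gtN1 mul2_neq0.
rewrite (natrS k) in h1.
apply: (mulfI (natr_neq0 k 1)).
have E : (k%:R + 2) * ngeg x k.+2 = (2 * x * (k%:R + 1 + l) * geg l x k.+1 -
   (k%:R + 2 * l) * geg l x k) / rbinom (2 * l) k.+2.
  by rewrite -geg_rec mulrA.
have -> : (k%:R + 2) * ((k%:R + 1 + 2 * l) * ngeg x k.+2 + (k%:R + 1) * ngeg x k) =
  (k%:R + 1 + 2 * l) * ((k%:R + 2) * ngeg x k.+2) +
  (k%:R + 2) * (k%:R + 1) * ngeg x k by ring.
rewrite E /ngeg !rbinomS !(natrS k); field.
by do ?[apply/andP; split];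
  first [exact: b | exact: h0 | exact: h1 | rewrite gt_eqF //; lra].
Qed.

Lemma ngeg_rec0 x : x * ngeg x 0 = ngeg x 1.
Proof.
by rewrite /ngeg geg0 geg1 rbinomS rbinom0; field.
Qed.

(** Compares the coefficients of [ngeg x (m + 2 * n + 2)] in the inductive step of [geg_psum_rec]:
    the left-hand side is the new boundary coefficient. *)
Lemma geg_coef_rec m n :
  (l + m%:R + 2 * n%:R + 2) * geg_coef m n.+1
  - (m%:R + 2 * n%:R + 3) * geg_coef m.+1 n.+1 =
  geg_coef m.+1 n * (m%:R + 2 * n%:R + 1 + 2 * l)
  - geg_coef m.+2 n * (l + m%:R + 2 + 2 * n%:R).
Proof.
have L12 := l12.
have m0 := ler0n R m; have n0 := ler0n R n.
rewrite /geg_coef !addSn !addnS !rbinomS !(natrS (m + n))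
  !(natrS m.+1) !(natrS m) !(natrS n) !natrD; field.
by do ?[apply/andP; split]; rewrite gt_eqF //; lra.
Qed.

Lemma geg_psum_rec m N x :
  2 * x * geg_psum m.+1 N x - geg_psum m N x - geg_psum m.+2 N x =
  ((l + m%:R + 2 * N%:R) * geg_coef m N
   - (m%:R + 2 * N%:R + 1) * geg_coef m.+1 N) * ngeg x (m + 2 * N).
Proof.
have L12 := l12.
elim: N => [|N IH].
  rewrite /geg_psum !big_geq // mulr0 !subr0.
  have m0 := ler0n R m.
  rewrite /geg_coef muln0 !addn0 rbinomS rbinom0 !(natrS m); field.
  by do ?[apply/andP; split]; rewrite gt_eqF //; lra.
rewrite /geg_psum !(big_nat_recr N) //= -!/(geg_psum _ _ _).
have -> : (m + 2 * N.+1 = (m + 2 * N).+2)%N by lia.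
have -> : (m.+1 + 2 * N = (m + 2 * N).+1)%N by lia.
have -> : (m.+2 + 2 * N = (m + 2 * N).+2)%N by lia.
have H := ngeg_rec x (m + 2 * N).
have H2 := geg_coef_rec m N.
rewrite natrD natrM in H.
set g0 := ngeg x (m + 2 * N) in IH H *; set g1 := ngeg x _.+1 in H *.
set g2 := ngeg x _.+2 in H *.
set P0 := geg_psum m N x in IH *; set P1 := geg_psum m.+1 N x in IH *.
set P2 := geg_psum m.+2 N x in IH *.
set c := geg_coef m.+1 N in IH H2 *.
rewrite !(natrS m.+1) !(natrS m) !(natrS N).
have -> : 2 * x * (P1 + c * (l + (m%:R + 1) + 2 * N%:R) * g1) -
   (P0 + geg_coef m N * (l + m%:R + 2 * N%:R) * g0) -
   (P2 + geg_coef m.+2 N * (l + (m%:R + 1 + 1) + 2 * N%:R) * g2) =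
   (2 * x * P1 - P0 - P2) + c * (2 * x * (l + (m%:R + 2 * N%:R) + 1) * g1) -
   geg_coef m N * (l + m%:R + 2 * N%:R) * g0 -
   geg_coef m.+2 N * (l + m%:R + 2 + 2 * N%:R) * g2 by ring.
rewrite IH H.
have -> : ((l + m%:R + 2 * (N%:R + 1)) * geg_coef m N.+1 -
   (m%:R + 2 * (N%:R + 1) + 1) * geg_coef m.+1 N.+1) * g2 =
   ((l + m%:R + 2 * N%:R + 2) * geg_coef m N.+1
  - (m%:R + 2 * N%:R + 3) * geg_coef m.+1 N.+1) * g2 by ring.
by rewrite H2; ring.
Qed.

(** Formally [geg_psum_rec] at m = -1, with the partial sum for -1 read as 0. *)
Lemma geg_psum_rec0 N x : 2 * x * geg_psum 0 N.+1 x - geg_psum 1 N.+1 x =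
  - (geg_coef 0 N.+1 * (2 * N%:R + 2) * ngeg x (2 * N).+1).
Proof.
have L12 := l12.
elim: N => [|N IH].
  rewrite /geg_psum !big_nat1 /= !muln0 !addn0 -ngeg_rec0.
  by rewrite /geg_coef !addn0 !add0n !rbinomS !rbinom0 (natrS 0); field.
rewrite /geg_psum !(big_nat_recr N.+1) //= -!/(geg_psum _ _ _).
have -> : (0 + 2 * N.+1 = (2 * N).+2)%N by lia.
have -> : (1 + 2 * N.+1 = (2 * N).+3)%N by lia.
have -> : ((2 * N.+1).+1 = (2 * N).+3)%N by lia.
have N0 := ler0n R N.
have H := ngeg_rec x (2 * N).+1.
rewrite (natrS (2 * N)) natrM in H.
set g1 := ngeg x (2 * N).+1 in IH H *; set g2 := ngeg x _.+2 in H *.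
set g3 := ngeg x _.+3 in H *.
set P0 := geg_psum 0 N.+1 x in IH *; set P1 := geg_psum 1 N.+1 x in IH *.
have E : geg_coef 0 N.+1 * (2 * N%:R + 2 + 2 * l) +
    geg_coef 0 N.+2 * (2 * N%:R + 4) = (l + 1 + 2 * (N%:R + 1)) * geg_coef 1 N.+1.
  rewrite /geg_coef !add0n add1n !rbinomS !(natrS N.+1) (natrS 0) !(natrS N); field.
  by do ?[apply/andP; split]; rewrite gt_eqF //; lra.
rewrite (natrS 0) (natrS N).
have -> : 2 * x * (P0 + geg_coef 0 N.+1 * (l + 0 + 2 * (N%:R + 1)) * g2) -
  (P1 + geg_coef 1 N.+1 * (l + (0 + 1) + 2 * (N%:R + 1)) * g3) =
  (2 * x * P0 - P1) + geg_coef 0 N.+1 * (2 * x * (l + (2 * N%:R + 1) + 1) * g2)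
  - (l + 1 + 2 * (N%:R + 1)) * geg_coef 1 N.+1 * g3 by ring.
by rewrite IH H -E; ring.
Qed.

Definition geg_coef0 n : R := geg_coef 0 n / rbinom (2 * l) (2 * n).

Lemma geg_coef0S n : geg_coef0 n.+1 * ((n%:R + 2) * (2 * l + 2 * n%:R + 1)) =
  geg_coef0 n * ((l - 1 + n%:R) * (2 * n%:R + 1)).
Proof.
have L12 := l12.
have n0 := ler0n R n.
have h0 := mul2_addl_natr_neq0 (2 * n); have h1 := mul2_addl_natr_neq0 (2 * n).+1.
have b := rbinom_neq0 _ (2 * n) mul2_gtN1 mul2_neq0.
rewrite (natrS (2 * n)) natrM in h1; rewrite natrM in h0.
have hl : l + n%:R != 0 := addl_natr_neq0 n.
have -> : geg_coef0 n.+1 = geg_coef 0 n.+1 / rbinom (2 * l) (2 * n).+2.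
  by rewrite /geg_coef0; congr (_ / rbinom _ _); lia.
rewrite /geg_coef0 /geg_coef !add0n !rbinomS !(natrS (2 * n)) !(natrS n) natrM; field.
by do ?[apply/andP; split];
  first [exact: b | exact: h0 | exact: h1 | rewrite gt_eqF //; lra].
Qed.

Definition geg_dpsum N x : R :=
  \sum_(0 <= n < N) geg_coef0 n * (l + 2 * n%:R) * dgeg l x (2 * n).

Lemma geg_psum0E N x : geg_psum 0 N x =
  \sum_(0 <= n < N) geg_coef0 n * (l + 2 * n%:R) * geg l x (2 * n).
Proof.
apply: eq_bigr => n _.
by rewrite /geg_coef0 /ngeg add0n addr0; ring.
Qed.

Lemma is_derive_geg_psum0 N x :
  is_derive x 1 (geg_psum 0 N) (geg_dpsum N x).
Proof.
rewrite (funext (geg_psum0E N)) /geg_dpsum.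
elim: N => [|N IH].
  rewrite big_geq // (_ : (fun y => _) = cst 0); first exact: is_derive_cst.
  by apply/funext => y; rewrite big_geq.
rewrite big_nat_recr //= (_ : (fun y => _) = (fun y =>
  \sum_(0 <= n < N) geg_coef0 n * (l + 2 * n%:R) * geg l y (2 * n)) +
  (geg_coef0 N * (l + 2 * N%:R)) \*: (fun y => geg l y (2 * N))); last first.
  by apply/funext => y; rewrite big_nat_recr.
apply: is_deriveD; apply: is_deriveZ; exact: is_derive_geg.
Qed.

(** With w = 1 - x^2, the left-hand side is w^(2 - l) times the derivative of w^(l - 1)
    [geg_psum 0 N.+1]. *)
Lemma geg_psum0_ode N x :
  (1 - x ^+ 2) * geg_dpsum N.+1 x - 2 * (l - 1) * x * geg_psum 0 N.+1 x =
  - (geg_coef0 N * (2 * N%:R + 1) * (N%:R + l - 1) * geg l x (2 * N).+1).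
Proof.
rewrite geg_psum0E; elim: N => [|N IH].
  rewrite /geg_dpsum !big_nat1 muln0 /= geg0 geg1; ring.
rewrite /geg_dpsum !(big_nat_recr N.+1) // -/(geg_dpsum _ _).
have N0 := ler0n R N.
have -> : (2 * N.+1 = (2 * N).+2)%N by lia.
have Hd := dgeg_struct l x (2 * N).+1.
have Hr := geg_rec l x (2 * N).+1.
have Hc := geg_coef0S N.
rewrite (natrS (2 * N)) natrM in Hd Hr; rewrite (natrS N).
set S := \sum_(0 <= n < N.+1) _ in IH *.
set D := geg_dpsum _ _ in IH *.
set g1 := geg l x _.+1 in IH Hd Hr *; set g2 := geg l x _.+2 in Hd Hr *.
set g3 := geg l x _.+3 in Hr *.
set d := dgeg l x _ in Hd *.
set c := geg_coef0 N in IH Hc *; set c' := geg_coef0 N.+1 in Hc *.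
have -> : (1 - x ^+ 2) * (D + c' * (l + 2 * (N%:R + 1)) * d) -
  2 * (l - 1) * x * (S + c' * (l + 2 * (N%:R + 1)) * g2) =
  ((1 - x ^+ 2) * D - 2 * (l - 1) * x * S) +
   c' * (l + 2 * (N%:R + 1)) * ((1 - x ^+ 2) * d) -
   c' * (N%:R + l) * (2 * x * (2 * N%:R + 1 + 1 + l) * g2) +
   c' * (l + 2 * (N%:R + 1)) * (2 * N%:R + 2) * x * g2 by ring.
rewrite IH Hd.
have -> : 2 * x * (2 * N%:R + 1 + 1 + l) * g2 =
  (2 * N%:R + 1 + 2) * g3 + (2 * N%:R + 1 + 2 * l) * g1 by rewrite Hr; ring.
have -> : c * (2 * N%:R + 1) * (N%:R + l - 1) * g1 =
  c' * ((N%:R + 2) * (2 * l + 2 * N%:R + 1)) * g1 by rewrite Hc; ring.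
ring.
Qed.

End Expansion.

(** * Decay of the boundary terms, and the value at 0 *)

Section Null.
Context {R : realType}.
Context (l : R).
Context (l12 : - (1 / 2) < l).
Context (l3 : l < 3).
Context (l0 : l != 0).
Implicit Types (x r : R) (m n N k : nat).

(** The size, of order k^(-l), by which [geg_bound] controls [ngeg x k] on [-r, r]. *)
Definition rbinom_quot k : R := rbinom l k / rbinom (2 * l) k.

Lemma rbinom_quotS k :
  rbinom_quot k.+1 = rbinom_quot k * ((l + k%:R) / (2 * l + k%:R)).
Proof.
have k0 := ler0n R k.
have h0 := mul2_addl_natr_neq0 l l12 l0 k.
have b := rbinom_neq0 _ k (mul2_gtN1 l l12) (mul2_neq0 l l0).
rewrite /rbinom_quot !rbinomS; field.
do ?[apply/andP; split]; first [exact: b | exact: h0 | rewrite gt_eqF //; lra].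
Qed.

Lemma geg_coefS m n : geg_coef l m n.+1 = geg_coef l m n *
  ((m%:R + n%:R + 1) / (m%:R + n%:R + 2) * ((l - 1 + n%:R) / (n%:R + 1)) *
   ((l + m%:R + n%:R) / (m%:R + n%:R + 1))).
Proof.
have m0 := ler0n R m; have n0 := ler0n R n.
rewrite /geg_coef !addnS !rbinomS !(natrS n) !natrD; field.
by do ?[apply/andP; split]; rewrite gt_eqF //; lra.
Qed.

Lemma geg_coef_null1 m :
  (l + m%:R + 2 * N%:R) * geg_coef l m N * rbinom_quot (m + 2 * N)
    @[N --> \oo] --> (0 : R).
Proof.
have L12 := l12; have L3 := l3.
have E : l - 3 = ((l + m%:R) / 2 + 1 - (l + m%:R) / 2) +
    (m%:R + 1 - (m%:R + 2)) + (l - 1 - 1) + (l + m%:R - (m%:R + 1)) +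
    ((l + m%:R) / 2 - (2 * l + m%:R) / 2) +
    ((l + m%:R + 1) / 2 - (2 * l + m%:R + 1) / 2) by lra.
(* The ratio of consecutive terms is left open and built by unification: each difference a - b in
   [E] contributes a factor (N + a) / (N + b). *)
eapply (raabe_cvg0 (l - 3)); first by lra.
  rewrite E; do 5!refine (raabeM _ _ _ _ _ (raabe_ratio _ _)).
  exact: raabe_ratio.
exists 1%N => // N /= N1.
have {}N1 : 1 <= N%:R :> R by rewrite ler1n.
have m0 := ler0n R m.
have -> : (m + 2 * N.+1 = (m + 2 * N).+2)%N by lia.
rewrite geg_coefS !rbinom_quotS !(natrS (m + 2 * N)) (natrS N) natrD natrM.
field.
by do ?[apply/andP; split]; rewrite gt_eqF //; lra.
Qed.

Lemma geg_coef_null2 m :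
  (m%:R + 2 * N%:R + 1) * geg_coef l m.+1 N * rbinom_quot (m + 2 * N)
    @[N --> \oo] --> (0 : R).
Proof.
have L12 := l12; have L3 := l3.
have E : l - 3 = ((m%:R + 1) / 2 + 1 - (m%:R + 1) / 2) +
    (m%:R + 2 - (m%:R + 3)) + (l - 1 - 1) + (l + m%:R + 1 - (m%:R + 2)) +
    ((l + m%:R) / 2 - (2 * l + m%:R) / 2) +
    ((l + m%:R + 1) / 2 - (2 * l + m%:R + 1) / 2) by lra.
eapply (raabe_cvg0 (l - 3)); first by lra.
  rewrite E; do 5!refine (raabeM _ _ _ _ _ (raabe_ratio _ _)).
  exact: raabe_ratio.
exists 1%N => // N /= N1.
have {}N1 : 1 <= N%:R :> R by rewrite ler1n.
have m0 := ler0n R m.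
have -> : (m + 2 * N.+1 = (m + 2 * N).+2)%N by lia.
rewrite geg_coefS !rbinom_quotS !(natrS (m + 2 * N)) (natrS N) !(natrS m) natrD natrM.
field.
by do ?[apply/andP; split]; rewrite gt_eqF //; lra.
Qed.

Lemma geg_coef_null3 :
  geg_coef l 0 N.+1 * (2 * N%:R + 2) * rbinom_quot (2 * N).+1
    @[N --> \oo] --> (0 : R).
Proof.
have L12 := l12; have L3 := l3.
have E : l - 3 = (2 - 1 : R) + (2 - 3) + (l - 2) + (l + 1 - 2) +
    ((l + 1) / 2 - (2 * l + 1) / 2) +
    ((l + 2) / 2 - (2 * l + 2) / 2) by lra.
eapply (raabe_cvg0 (l - 3)); first by lra.
  rewrite E; do 5!refine (raabeM _ _ _ _ _ (raabe_ratio _ _)).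
  exact: raabe_ratio.
exists 1%N => // N /= N1.
have {}N1 : 1 <= N%:R :> R by rewrite ler1n.
have -> : ((2 * N.+1).+1 = (2 * N).+3)%N by lia.
rewrite (geg_coefS 0 N.+1) !rbinom_quotS !(natrS (2 * N).+1) !(natrS (2 * N)).
rewrite !(natrS N) natrM; field.
by do ?[apply/andP; split]; rewrite gt_eqF //; lra.
Qed.

(* Weight of the correction [C_(2N+2) - C_(2N)] that cancels the boundary term
   of [geg_psum0_ode]. *)
Definition ode_coef N : R := geg_coef0 l N * (2 * N%:R + 1) *
  (N%:R + l - 1) / (2 * (2 * N%:R + 1 + l)).

Lemma ode_coef_null0 : ode_coef N * rbinom l (2 * N) @[N --> \oo] --> (0 : R).
Proof.
have L12 := l12; have L3 := l3.
have E : l - 3 = (l - 1 - 2) + (1 / 2 - (l + 1 / 2)) + (3 / 2 - 1 / 2) +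
    (l - (l - 1)) + ((l + 1) / 2 - (l + 3) / 2) + (l / 2 - 1 / 2) +
    ((l + 1) / 2 - 1) by lra.
eapply (raabe_cvg0 (l - 3)); first by lra.
  rewrite E; do 6!refine (raabeM _ _ _ _ _ (raabe_ratio _ _)).
  exact: raabe_ratio.
(* The ratio divides by N + l - 1, whose positivity is certain only from N = 2 on. *)
exists 2%N => // N /= N2.
have {}N2 : 2 <= N%:R :> R by rewrite ler_nat.
have d : (N%:R + 2) * (2 * l + 2 * N%:R + 1) != 0.
  by rewrite mulf_neq0 // gt_eqF //; lra.
have -> : (2 * N.+1 = (2 * N).+2)%N by lia.
rewrite /ode_coef -[geg_coef0 l N.+1](mulfK d) (geg_coef0S l l12 l0).
rewrite !rbinomS !(natrS (2 * N)) !(natrS N) natrM; field.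
by do ?[apply/andP; split]; rewrite gt_eqF //; lra.
Qed.

Lemma ode_coef_null2 : ode_coef N * rbinom l (2 * N).+2 @[N --> \oo] --> (0 : R).
Proof.
have L12 := l12.
have : ode_coef N * rbinom l (2 * N) * ((N%:R + l / 2) / (N%:R + 1 / 2) *
   ((N%:R + (l + 1) / 2) / (N%:R + 1))) @[N --> \oo] --> 0 * ((1 : R) * 1).
  apply: cvgM; first exact: ode_coef_null0.
  by apply: cvgM; exact: cvg_natr_ratio.
rewrite mul0r; apply: cvg_trans; apply: near_eq_cvg; apply: nearW => N.
have N0 := ler0n R N.
rewrite !rbinomS !(natrS (2 * N)) natrM; field.
by do ?[apply/andP; split]; rewrite gt_eqF //; lra.
Qed.

(** At 0 the three-term recurrence has two terms only, so C_(2n)(0) = (-1)^n (l)_n / n!; the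
    remaining factors come from [geg_coef0S]. *)
Lemma geg_psum0_at0_rec : wp_rec l (fun n => geg_coef0 l n * (l + 2 * n%:R) *
  geg l 0 (2 * n)).
Proof.
move=> n; have L12 := l12; have n0 := ler0n R n.
have Hr := geg_rec l 0 (2 * n).
have Hc := geg_coef0S l l12 l0 n.
have -> : (2 * n.+1 = (2 * n).+2)%N by lia.
have d : (n%:R + 2) * (2 * l + 2 * n%:R + 1) != 0.
  by rewrite mulf_neq0 // gt_eqF //; lra.
have -> : geg l 0 (2 * n).+2 = - ((2 * n%:R + 2 * l) * geg l 0 (2 * n)) / (2 * n%:R + 2).
  apply: (mulfI (natr_neq0 (2 * n) 1)); rewrite Hr natrM; field.
  by rewrite gt_eqF //; lra.
rewrite -[geg_coef0 l n.+1](mulfK d) Hc (natrS n); field.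
by do ?[apply/andP; split]; rewrite gt_eqF //; lra.
Qed.

Definition gamma_const : R := 2 * Gamma (l + 1 / 2) / (Num.sqrt pi * Gamma l).

Lemma geg_psum0_at0_cvg : geg_psum l 0 N.+1 0 @[N --> \oo] --> gamma_const.
Proof.
pose t n := geg_coef0 l n * (l + 2 * n%:R) * geg l 0 (2 * n).
have S : series t @ \oo --> gamma_const.
  apply: (wp_series_cvg l t) => //; first by rewrite l12 l3.
    exact: geg_psum0_at0_rec.
  have -> : t 0%N = l.
    by rewrite /t /geg_coef0 /geg_coef !muln0 !rbinom0 geg0 !addr0 !add0r; field.
  exact: Gamma_quot_cvg.
move: S; rewrite -cvg_shiftS; apply: cvg_trans.
by apply: near_eq_cvg; apply: nearW => N; rewrite geg_psum0E.
Qed.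

End Null.

(** * Uniform convergence *)

Section UniformConvergence.
Context {R : realType}.
Implicit Types (P Q : nat -> R -> R) (f g : R -> R) (r x : R).

Definition unif_cvg r P f := exists2 e : nat -> R, e @ \oo --> (0 : R) &
  forall N x, `|x| <= r -> `|P N x - f x| <= e N.

Lemma cvg0_norm (u : nat -> R) : u @ \oo --> (0 : R) ->
  `|u n| @[n --> \oo] --> (0 : R).
Proof.
move=> /cvgrPdist_le H; apply/cvgrPdist_le => e e0.
by apply: filterS (H e e0) => n; rewrite !sub0r !normrN normr_id.
Qed.

Lemma cvg0Z (c : R) (u : nat -> R) : u @ \oo --> (0 : R) ->
  c * u n @[n --> \oo] --> (0 : R).
Proof.
by move=> H; rewrite -[X in _ --> X](mulr0 c); apply: cvgM => //; exact: cvg_cst.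
Qed.

Lemma cvg0D (u v : nat -> R) : u @ \oo --> (0 : R) -> v @ \oo --> (0 : R) ->
  u n + v n @[n --> \oo] --> (0 : R).
Proof. by move=> Hu Hv; rewrite -[X in _ --> X]addr0; apply: cvgD. Qed.

(** The exponents to be bounded are 1 - l, l - 2 and l - 3 with -1/2 < l < 3, all above -4, so one
    constant serves for them all. *)
Lemma powR_le_expV (d w a : R) : 0 < d <= w -> w <= 1 -> - 4 <= a ->
  w `^ a <= d ^- 4.
Proof.
move=> /andP[d0 dw] w1 a4; have w0 : 0 < w by exact: lt_le_trans dw.
apply: (@le_trans _ _ (w `^ (- 4%:R))).
  by apply: ger_powR; rewrite ?w0.
rewrite powR_invn ?(ltW w0) // lef_pV2 ?posrE ?exprn_gt0 //.
by rewrite lerXn2r ?nnegrE // ltW.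
Qed.

(** Since r < 1, the distance from 0 to x is at most 1, and the bound on the derivative bounds the
    increment without a further factor. *)
Lemma mean_value_bound r (c : R) f df : r < 1 -> (forall x, `|x| <= r ->
    is_derive x 1 f (df x) /\ `|df x| <= c) ->
  forall x, `|x| <= r -> `|f x - f 0| <= c.
Proof.
move=> r1 H x xr.
have r0 : 0 <= r by exact: le_trans xr.
have c0 : 0 <= c.
  by have [] := H 0; rewrite ?normr0 // => _; exact: le_trans.
have main a b : a <= b -> `|a| <= r -> `|b| <= r -> b - a <= 1 ->
    `|f b - f a| <= c.
  move=> ab ar br ba1.
  have inr y : y \in `[a, b] -> `|y| <= r.
    rewrite in_itv /= => /andP[h1 h2]; rewrite ler_norml.
    move: ar br; rewrite !ler_norml => /andP[a1 _] /andP[_ b1].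
    by rewrite (le_trans a1 h1) (le_trans h2 b1).
  have cf : {within `[a, b], continuous f}.
    apply/subspace_continuousP => y ay; apply: cvg_within_filter.
    have [[dy _] _] := H y (inr y ay).
    by apply/differentiable_continuous; rewrite -derivable1_diffP.
  have dF y : y \in `]a, b[ -> is_derive y 1 f (df y).
    move=> ay; have [] := H y _ => //; apply: inr.
    by move: ay; rewrite !in_itv /= => /andP[/ltW -> /ltW ->].
  have [y ay ->] := MVT_segment ab dF cf.
  rewrite normrM; have [_ dc] := H y (inr y ay).
  rewrite [X in _ * X]ger0_norm ?subr_ge0 //.
  by apply: le_trans dc; rewrite ler_piMr.
have [x0|x0] := leP 0 x.
  apply: main; rewrite ?normr0 ?subr0 //.
  by move: xr; rewrite ler_norml; lra.
rewrite distrC; apply: main; rewrite ?normr0 ?sub0r // ?ltW //.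
by move: xr; rewrite ler_norml; lra.
Qed.

Lemma compact_subset_oo (K : set R) : compact K -> K `<=` `]-1, 1[%classic ->
  exists2 r, 0 < r < 1 & forall x, K x -> `|x| <= r.
Proof.
move=> cK KI; have [->|K0] := eqVneq K set0.
  by exists (1 / 2) => //; apply/andP; split; lra.
have nK : {within K, continuous (fun x : R => `|x|)}.
  by apply: continuous_subspaceT => x; exact: norm_continuous.
move/set0P: K0 => K0.
have [c /set_mem cin H] := compact_EVT_max K0 cK nK.
have := KI _ cin; rewrite /= in_itv /= => /andP[c1 c2].
have nc : `|c| < 1 by rewrite ltr_norml c1.
have nc0 := normr_ge0 c.
exists ((`|c| + 1) / 2); first by apply/andP; split; lra.
by move=> x Kx; apply: (le_trans (H x (mem_set Kx))); lra.
Qed.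

End UniformConvergence.

(** * The limit of the partial sums *)

Section Main.
Context {R : realType}.
Context (l : R).
Context (l12 : - (1 / 2) < l).
Context (l3 : l < 3).
Context (l0 : l != 0).
Implicit Types (x r : R) (m n N k : nat).

Definition expansion_limit x : R := gamma_const l * (1 - x ^+ 2) `^ (1 - l).

Lemma ngeg_bound r : 0 < r < 1 ->
  exists M, forall k x, `|x| <= r -> `|ngeg l x k| <= M * `|rbinom_quot l k|.
Proof.
move=> r01; have [M HM] := geg_bound l r l12 l0 r01.
exists M => k x xr.
rewrite /ngeg /rbinom_quot (normrM (geg l x k)) (normrM (rbinom l k)) mulrA.
by apply: ler_wpM2r => //; exact: HM.
Qed.

Lemma is_derive_weight (a x : R) : `|x| < 1 ->
  is_derive x 1 (fun y => (1 - y ^+ 2) `^ a)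
    (a * (1 - x ^+ 2) `^ (a - 1) * (- (2 * x))).
Proof.
move=> x1.
have w0 : 0 < 1 - x ^+ 2 by rewrite subr_gt0 -real_normK ?num_real // expr_lt1.
have dB : is_derive x 1 (fun y : R => 1 - y ^+ 2) (- (2 * x)).
  by apply: is_derive_eq; rewrite /GRing.scale /=; ring.
have dP := is_derive1_powR a w0.
exact: (@is_derive1_comp _ (fun u => u `^ a) (fun y : R => 1 - y ^+ 2) x _ _ dP dB).
Qed.

Lemma geg_psum0_unif_cvg r : 0 < r < 1 ->
  unif_cvg r (fun N => geg_psum l 0 N.+1) expansion_limit.
Proof.
move=> r01; have L12 := l12; have L3 := l3.
have [M HM] := geg_bound l r l12 l0 r01.
have [r0 r1] := andP r01.
pose d := 1 - r ^+ 2.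
have d0 : 0 < d by rewrite subr_gt0 expr_lt1 // ltW.
pose W := d ^- 4.
have W0 : 0 <= W by rewrite invr_ge0 exprn_ge0 // ltW.
have wb x : `|x| <= r -> 0 < d <= 1 - x ^+ 2.
  move=> xr; rewrite d0 lerD2l lerN2 -real_normK ?num_real //.
  by rewrite lerXn2r ?nnegrE // ltW.
have wpow x a : `|x| <= r -> - 4 <= a -> (1 - x ^+ 2) `^ a <= W.
  move=> xr a4; apply: powR_le_expV => //; first exact: wb.
  by rewrite gerBl sqr_ge0.
pose eps N := M * `|ode_coef l N * rbinom l (2 * N)| +
   M * `|ode_coef l N * rbinom l (2 * N).+2|.
have eps0 : eps @ \oo --> (0 : R).
  apply: cvg0D; apply: cvg0Z; apply: cvg0_norm.
    exact: ode_coef_null0.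
  exact: ode_coef_null2.
pose g N x := geg l x (2 * N).+2 - geg l x (2 * N).
have geps N x : `|x| <= r -> `|ode_coef l N * g N x| <= eps N.
  move=> xr; rewrite /g mulrBr; apply: (le_trans (ler_normB _ _)).
  rewrite /eps addrC !(normrM (ode_coef l N)).
  by apply: lerD; rewrite mulrCA ler_wpM2l //; exact: HM.
have eps_ge0 N : 0 <= eps N.
  by apply: le_trans (geps N 0 _) => //; rewrite normr0 ltW.
(* By [dgeg_add2] the derivative of [g N] is a multiple of C_(2N+1), and [ode_coef] is chosen so
   that it cancels the right-hand side of [geg_psum0_ode]. Only the derivative of the weight w^(l -
   2) of the correction survives, and this is [dpsi]. *)
pose psi N x := (1 - x ^+ 2) `^ (l - 1) * geg_psum l 0 N.+1 x +
  ode_coef l N * ((1 - x ^+ 2) `^ (l - 2) * g N x).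
pose dpsi N x := - (2 * x * (l - 2)) * (1 - x ^+ 2) `^ (l - 3) *
  (ode_coef l N * g N x).
pose c := 2 * `|l - 2| * W.
have c0 : 0 <= c by rewrite !mulr_ge0.
have psiB N x : `|x| <= r -> `|psi N x - psi N 0| <= c * eps N.
  apply: (@mean_value_bound _ r (c * eps N) _ (dpsi N)) => // {}x xr.
  have x1 : `|x| < 1 by exact: le_lt_trans r1.
  split.
    have D1 := is_derive_weight (l - 1) x x1.
    have D2 := is_derive_weight (l - 2) x x1.
    have DP := is_derive_geg_psum0 l N.+1 x.
    have Dg : is_derive x 1 (g N) (dgeg l x (2 * N).+2 - dgeg l x (2 * N)).
      by apply: is_deriveB; exact: is_derive_geg.
    have DD := is_deriveD (is_deriveM D1 DP)
      (is_deriveZ (ode_coef l N) (is_deriveM D2 Dg)).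
    have N0 := ler0n R N.
    have w0 : 0 < 1 - x ^+ 2 by have /andP[] := wb x xr; exact: lt_le_trans.
    have ode := geg_psum0_ode l l12 l0 N x.
    have e1 : l - 1 - 1 = l - 2 by lra.
    have e2 : l - 2 - 1 = l - 3 by lra.
    have e3 : (1 - x ^+ 2) `^ (l - 1) = (1 - x ^+ 2) `^ (l - 2) * (1 - x ^+ 2).
      rewrite -{3}[1 - x ^+ 2]powRr1 ?(ltW w0) // -powRD.
        by congr (_ `^ _); lra.
      by rewrite (gt_eqF w0) implybT.
    have gd : dgeg l x (2 * N).+2 - dgeg l x (2 * N) =
        2 * (2 * N%:R + 1 + l) * geg l x (2 * N).+1.
      by rewrite dgeg_add2 natrM.
    apply: (@is_derive_eq _ _ _ _ _ _ _ _ DD).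
    rewrite /GRing.scale /= gd e1 e2 e3 /dpsi.
    set w2 := _ `^ (l - 2); set w3 := _ `^ (l - 3).
    set D := geg_dpsum l N.+1 x in ode *; set S := geg_psum l 0 N.+1 x in ode *.
    have oc : ode_coef l N * (2 * (2 * N%:R + 1 + l)) =
       geg_coef0 l N * (2 * N%:R + 1) * (N%:R + l - 1).
      by rewrite /ode_coef divfK // gt_eqF //; lra.
    transitivity (w2 * ((1 - x ^+ 2) * D - 2 * (l - 1) * x * S +
       ode_coef l N * (2 * (2 * N%:R + 1 + l)) * geg l x (2 * N).+1) +
       - (2 * x * (l - 2)) * w3 * (ode_coef l N * g N x)); first ring.
    by rewrite ode oc addNr mulr0 add0r.
  rewrite normrM ler_pM ?normr_ge0 //; last exact: geps.
  rewrite normrM normrN (ger0_norm (powR_ge0 _ _)) ler_pM ?powR_ge0 //.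
    rewrite !normrM (gtr0_norm (_ : 0 < 2)) // -mulrA ler_pM2l //.
    by rewrite ler_piMl // ltW.
  by apply: wpow => //; lra.
have AN : `|geg_psum l 0 N.+1 0 - gamma_const l| @[N --> \oo] --> (0 : R).
  apply: cvg0_norm; rewrite -[X in _ --> X](subrr (gamma_const l)).
  apply: cvgB; last exact: cvg_cst.
  exact: geg_psum0_at0_cvg.
exists (fun N => W * (`|geg_psum l 0 N.+1 0 - gamma_const l| +
   (c + W + 1) * eps N)).
  by apply: cvg0Z; apply: cvg0D => //; exact: cvg0Z.
move=> N x xr.
have /andP[_ dw] := wb x xr.
have w0 : 0 < 1 - x ^+ 2 by exact: lt_le_trans dw.
have inv : (1 - x ^+ 2) `^ (1 - l) * (1 - x ^+ 2) `^ (l - 1) = 1.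
  rewrite -powRD; last by rewrite (gt_eqF w0) implybT.
  by rewrite addrA subrK subrr powRr0.
have -> : geg_psum l 0 N.+1 x - expansion_limit x = (1 - x ^+ 2) `^ (1 - l) *
   ((1 - x ^+ 2) `^ (l - 1) * geg_psum l 0 N.+1 x - gamma_const l).
  by rewrite mulrBr mulrA inv mul1r [_ * gamma_const l]mulrC.
rewrite normrM ger0_norm ?powR_ge0 // ler_pM ?powR_ge0 //.
  by apply: wpow => //; lra.
(* All powers of 1 - x^2 are 1 at x = 0, so [psi N 0] differs from the partial sum at 0 only by
   [ode_coef l N * g N 0]. *)
have -> : (1 - x ^+ 2) `^ (l - 1) * geg_psum l 0 N.+1 x - gamma_const l =
  (psi N x - psi N 0) + (geg_psum l 0 N.+1 0 - gamma_const l) +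
  (ode_coef l N * g N 0 - (1 - x ^+ 2) `^ (l - 2) * (ode_coef l N * g N x)).
  by rewrite /psi expr0n subr0 !powR1; ring.
have z0 : `|0 : R| <= r by rewrite normr0 ltW.
apply: (le_trans (ler_normD _ _)).
have h1 : `|ode_coef l N * g N 0 - (1 - x ^+ 2) `^ (l - 2) *
    (ode_coef l N * g N x)| <= (W + 1) * eps N.
  apply: (le_trans (ler_normB _ _)); rewrite mulrDl mul1r addrC.
  apply: lerD; last exact: geps.
  rewrite normrM ger0_norm ?powR_ge0 // ler_pM ?powR_ge0 //; last exact: geps.
  by apply: wpow => //; lra.
have h2 : `|psi N x - psi N 0 + (geg_psum l 0 N.+1 0 - gamma_const l)| <=
    c * eps N + `|geg_psum l 0 N.+1 0 - gamma_const l|.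
  by apply: (le_trans (ler_normD _ _)); rewrite lerD2r psiB.
apply: (le_trans (lerD h2 h1)).
by rewrite le_eqVlt; apply/orP; left; apply/eqP; ring.
Qed.

(** The [geg 1 x m] are the U_m, so the limits satisfy exactly the recurrence that the partial sums
    satisfy up to boundary terms. As |x| <= 1, the errors of two consecutive m combine to 2 e' + e
    plus those terms. *)
Lemma geg_psum_unif_cvg m r : 0 < r < 1 ->
  unif_cvg r (fun N => geg_psum l m N.+1) (fun x => geg 1 x m * expansion_limit x).
Proof.
move=> r01; have [M HM] := ngeg_bound r r01.
have [r0 r1] := andP r01.
have [e0 E0 H0] := geg_psum0_unif_cvg r r01.
suff [] : unif_cvg r (fun N => geg_psum l m N.+1)
      (fun x => geg 1 x m * expansion_limit x) /\
    unif_cvg r (fun N => geg_psum l m.+1 N.+1)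
      (fun x => geg 1 x m.+1 * expansion_limit x) by [].
elim: m => [|m [[e Ee He] [e' Ee' He']]].
  split; first by exists e0 => // N x xr; rewrite geg0 mul1r H0.
  exists (fun N => 2 * e0 N + M * `|geg_coef l 0 N.+1 * (2 * N%:R + 2) *
      rbinom_quot l (2 * N).+1|).
    apply: cvg0D; first exact: cvg0Z.
    by apply: cvg0Z; apply: cvg0_norm; exact: geg_coef_null3.
  move=> N x xr.
  have := geg_psum_rec0 l l12 l0 N x.
  set b := geg_coef l 0 N.+1 * _ => Hr.
  have -> : geg_psum l 1 N.+1 x - geg 1 x 1 * expansion_limit x =
     2 * x * (geg_psum l 0 N.+1 x - expansion_limit x) + b * ngeg l x (2 * N).+1.
    rewrite geg1 mulr1 -[b * _]opprK -Hr; ring.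
  apply: (le_trans (ler_normD _ _)); apply: lerD.
    rewrite normrM ler_pM // ?H0 // normrM gtr0_norm // ler_piMr //.
    by apply: le_trans xr (ltW r1).
  by rewrite -/b (normrM b) (normrM b) mulrCA; apply: ler_wpM2l => //; exact: HM.
split; first by exists e'.
pose b1 N := (l + m%:R + 2 * N%:R) * geg_coef l m N * rbinom_quot l (m + 2 * N).
pose b2 N := (m%:R + 2 * N%:R + 1) * geg_coef l m.+1 N * rbinom_quot l (m + 2 * N).
exists (fun N => (2 * e' N + e N) + M * (`|b1 N.+1| + `|b2 N.+1|)).
  apply: cvg0D; first by apply: cvg0D => //; exact: cvg0Z.
  apply: cvg0Z; apply: cvg0D.
    have := cvg0_norm _ (geg_coef_null1 l l12 l3 l0 m).
    by rewrite -cvg_shiftS.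
  have := cvg0_norm _ (geg_coef_null2 l l12 l3 l0 m).
  by rewrite -cvg_shiftS.
move=> N x xr.
have Hr := geg_psum_rec l l12 l0 m N.+1 x.
have U : geg 1 x m.+2 = 2 * x * geg 1 x m.+1 - geg 1 x m.
  by apply: (mulfI (natr_neq0 m 1)); rewrite geg_rec; ring.
set B := _ * ngeg l x _ in Hr.
have -> : geg_psum l m.+2 N.+1 x - geg 1 x m.+2 * expansion_limit x =
    2 * x * (geg_psum l m.+1 N.+1 x - geg 1 x m.+1 * expansion_limit x) -
    (geg_psum l m N.+1 x - geg 1 x m * expansion_limit x) - B.
  by rewrite U -Hr; ring.
apply: (le_trans (ler_normB _ _)); apply: lerD.
  apply: (le_trans (ler_normB _ _)); apply: lerD; last exact: He.
  rewrite normrM ler_pM // ?He' // normrM gtr0_norm // ler_piMr //.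
  by apply: le_trans xr (ltW r1).
rewrite /B mulrBl; apply: (le_trans (ler_normB _ _)).
rewrite mulrDr; apply: lerD.
  rewrite /b1; move: (_ * geg_coef _ _ _) => a.
  by rewrite (normrM a) (normrM a) mulrCA; apply: ler_wpM2l => //; exact: HM.
rewrite /b2; move: (_ * geg_coef _ _ _) => a.
by rewrite (normrM a) (normrM a) mulrCA; apply: ler_wpM2l => //; exact: HM.
Qed.

End Main.

(** * Chebyshev polynomials and the expansion *)

Section Chebyshev.
Context {R : realType}.

(** For l = 1 the factor m + 2 cancels from the Gegenbauer recurrence, leaving the one that the
    addition formulas give for the sines. *)
Lemma sin_geg1 (t : R) (m : nat) :
  sin (m.+1%:R * t) = geg 1 (cos t) m * sin t.
Proof.
suff [] : sin (m.+1%:R * t) = geg 1 (cos t) m * sin t /\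
  sin (m.+2%:R * t) = geg 1 (cos t) m.+1 * sin t by [].
elim: m => [|m [IH1 IH2]].
  rewrite mul1r geg0 mul1r geg1 (_ : 2%:R * t = t + t); last by ring.
  by split => //; rewrite sinD; ring.
split => //.
have U : geg 1 (cos t) m.+2 = 2 * cos t * geg 1 (cos t) m.+1 - geg 1 (cos t) m.
  by apply: (mulfI (natr_neq0 m 1)); rewrite geg_rec; ring.
rewrite U mulrBl -IH1 -[_ * geg 1 (cos t) m.+1 * _]mulrA -IH2.
have -> : m.+3%:R * t = m.+2%:R * t + t by rewrite -[m.+3%:R]natr1; ring.
have -> : m.+1%:R * t = m.+2%:R * t - t by rewrite -[m.+2%:R]natr1; ring.
rewrite sinD sinB; ring.
Qed.

Lemma chebyshevUE m (U : {poly R}) x : is_chebyshevU m U -> -1 < x < 1 ->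
  U.[x] = geg 1 x m.
Proof.
move=> HU /andP[x1 x2].
have xI : x \in `[-1, 1] by rewrite in_itv /= !ltW.
have := HU (acos x); rewrite sin_geg1 acosK // => H.
apply: (mulIf _ H); rewrite gt_eqF // sin_gt0_pi //.
by rewrite acos_gt0 ?acos_ltpi ?x1 ?x2 ?ltW.
Qed.

End Chebyshev.

Theorem theorem3 (R : realType) (m : nat) (lambda : R)
    (U : {poly R}) (C : nat -> {poly R})
    (lambda_itv : - (1 / 2) < lambda < 3) (lambda_neq0 : lambda != 0)
    (U_chebyshev : is_chebyshevU m U) (C_gegenbauer : is_gegenbauer lambda C) :
  (forall x : R, -1 < x < 1 ->
     cvgn (series (gegenbauer_term m lambda C x)) /\
     U.[x] / (1 - x ^+ 2) `^ (lambda - 1) =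
       (m + 1)%:R * Num.sqrt pi * Gamma lambda / (2 * Gamma (lambda + 1 / 2))
       * limn (series (gegenbauer_term m lambda C x))) /\
  (forall K : set R, compact K -> K `<=` `]-1, 1[ ->
     {uniform K,
       (fun N x => series (gegenbauer_term m lambda C x) N) @ \oo -->
       (fun x => limn (series (gegenbauer_term m lambda C x)))}).
Proof.
have [l12 l3] := andP lambda_itv.
pose S x := geg 1 x m * expansion_limit lambda x / (m%:R + 1).
have m1 : 0 < m%:R + 1 :> R by rewrite natr1.
have serE x N : -1 < x < 1 ->
    series (gegenbauer_term m lambda C x) N = geg_psum lambda m N x / (m%:R + 1).
  move=> x11; rewrite /series /= /geg_psum mulr_suml; apply: eq_bigr => n _.
  have mn : 0 < m%:R + n%:R + 1 :> R by rewrite -natrD natr1.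
  rewrite /gegenbauer_term (gegenbauerE _ _ _ _ C_gegenbauer x11).
  have b := rbinom_neq0 _ (m + 2 * n) (mul2_gtN1 _ l12) (mul2_neq0 _ lambda_neq0).
  rewrite /ngeg /geg_coef !natrD; field.
  by do ?[apply/andP; split]; first [exact: b | rewrite gt_eqF].
have unif r : 0 < r < 1 -> exists2 e : nat -> R, e @ \oo --> (0 : R) &
    forall N x, `|x| <= r ->
    `|series (gegenbauer_term m lambda C x) N.+1 - S x| <= e N.
  move=> r01; have [e E H] := geg_psum_unif_cvg lambda l12 l3 lambda_neq0 m r r01.
  exists (fun N => (m%:R + 1)^-1 * e N); first exact: cvg0Z.
  move=> N x xr; rewrite serE; last first.
    by rewrite -ltr_norml (le_lt_trans xr) //; case/andP: r01.
  rewrite /S -mulrBl normrM mulrC ger0_norm ?invr_ge0 ?(ltW m1) //.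
  by rewrite ler_wpM2l ?invr_ge0 ?(ltW m1) ?H.
have cvgS x : -1 < x < 1 -> series (gegenbauer_term m lambda C x) @ \oo --> S x.
  rewrite -ltr_norml => x1; have x0 := normr_ge0 x.
  have r01 : 0 < (1 + `|x|) / 2 < 1 by apply/andP; split; lra.
  have [e E H] := unif _ r01.
  rewrite -cvg_shiftS; apply/cvgrPdist_le => d d0.
  move/cvgrPdist_le: E => /(_ d d0); apply: filterS => N.
  rewrite sub0r normrN distrC => h; apply: le_trans h.
  by apply: le_trans (H N x _) (ler_norm _); lra.
split=> [x x11|K cK KI].
  split; first by apply/cvg_ex; exists (S x); exact: cvgS.
  rewrite (cvg_lim _ (cvgS x x11)) // (chebyshevUE _ _ _ U_chebyshev x11).
  have p1 : 0 < lambda + 1 / 2 by lra.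
  have p2 : 0 < lambda + 1 by lra.
  have G1 : Gamma (lambda + 1 / 2) != 0.
    by rewrite Gamma_gt0E // gt_eqF // Gamma_integral_gt0.
  have G2 : Gamma lambda != 0.
    have := Gamma_integral_gt0 _ p2; rewrite -mulr_Gamma //.
    by apply: contraTneq => ->; rewrite mulr0 ltxx.
  have sp : Num.sqrt pi != 0 :> R by rewrite gt_eqF // sqrtr_gt0 pi_gt0.
  rewrite -powRN opprB /S /expansion_limit /gamma_const natrD.
  field; rewrite G1 G2 sp; rewrite gt_eqF //.
have [r r01 Kr] := compact_subset_oo K cK KI.
have [e E H] := unif r r01.
move=> V /uniform_nbhs [A [entA AV]].
move: entA; rewrite -entourage_from_ballE => -[d /= d0 dA].
move/cvgrPdist_lt: E => /(_ d d0) [N0 _ HN].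
(* The error sequence at N controls the partial sum of index N + 1, hence the shift of the
   threshold. *)
exists N0.+1 => // N /= N1; apply: AV => y Ky.
have y11 : -1 < y < 1 by have := KI y Ky; rewrite /= in_itv.
apply: dA; rewrite /ball /= (cvg_lim _ (cvgS y y11)) // distrC.
case: N N1 => // N N1.
apply: le_lt_trans (H N y (Kr y Ky)) _.
by have := HN N N1; rewrite /= sub0r normrN; apply: le_lt_trans; exact: ler_norm.
Qed.
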